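(* Let $n\to+\infty$, let $m=m(n)$ be such that $m/n$ converges to $\gamma_o^2$ for some $\gamma_o>0$, and put $\mu=\sqrt{nm}$ and $\gamma=\sqrt{m/n}$. For each $n$ let $y_1,\dots,y_n$ and $x_1,\dots,x_m$ be positive weights, and assume that for some constant $c>0$ (not depending on $n$) we have $\langle x^5\rangle<c$ and $\langle y^4\rangle<c$ for all $n$. Let $G'$ be the affiliation random graph defined by these weights and $\mu$ (see context). Then, as $n\to+\infty$, the number of triangles $N_\Delta(G')$ and the number of $2$-paths $N_\Lambda(G')$ satisfy $$N_\Delta(G')=\frac{n}{6\gamma}\langle x^3\rangle\langle y\rangle^3+O_P(\sqrt n),$$ $$N_\Lambda(G')=\frac{n}{2\gamma}\langle x^3\rangle\langle y\rangle^3+\frac n2\langle x^2\rangle^2\langle y^2\rangle\langle y\rangle^2+O_P(\sqrt n).$$ In particular, the global clustering coefficient satisfies $$C^{GL}(G')=\frac{\langle x^3\rangle\langle y\rangle^3}{\langle x^3\rangle\langle y\rangle^3+\gamma_o\langle x^2\rangle^2\langle y^2\rangle\langle y\rangle^2}+o_P(1).$$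
   Context: Let $V=\{1,\dots,n\}$ and $W=\{1,\dots,m\}$ (regarded as disjoint sets). Given $\mu>0$ and positive weights $y_1,\dots,y_n$, $x_1,\dots,x_m$, let $H$ be the random bipartite graph with bipartition $V\cup W$ in which the edges $i\sim u$, $(i,u)\in V\times W$, are present independently with probabilities $$p_{iu}=\frac{y_ix_u}{y_ix_u+\mu}.$$ The affiliation random graph $G'$ has vertex set $V$, and two distinct vertices $i,j\in V$ are adjacent in $G'$ iff they have a common neighbour in $H$. Notation: $\langle x^s\rangle=\frac1m\sum_{u=1}^m x_u^s$, $\langle y^s\rangle=\frac1n\sum_{i=1}^n y_i^s$, $\langle y\rangle=\langle y^1\rangle$. For a graph $G$ on $V$, $N_\Delta(G)$ is the number of triangles of $G$, $N_\Lambda(G)=\sum_{v\in V}\binom{d_v(G)}{2}$ is the number of $2$-paths, where $d_v(G)$ is the degree of $v$ in $G$, and $C^{GL}(G)=\frac{3N_\Delta(G)}{N_\Lambda(G)}$, with $C^{GL}(G)=0$ when $N_\Delta(G)=0$. $O_P(a_n)$ denotes a sequence of random variables $Z_n$ such that $Z_n/a_n$ is bounded in probability (tight); $o_P(1)$ denotes a sequence converging to $0$ in probability.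
   Formalization: The clustering coefficient claim is proved under the added assumption that √n(⟨x³⟩⟨y⟩³+γ_o⟨x²⟩²⟨y²⟩⟨y⟩²) → ∞; without non-degeneracy it fails, e.g. for m=n, x_u=1, y_i=n^{-10}. *)

(* Defs.v *)
(* MathComp-Analysis *)
From HB Require Import structures.
From mathcomp Require Export all_boot all_order all_algebra.
From mathcomp Require Export all_classical all_reals all_analysis.

Set Implicit Arguments.
Unset Strict Implicit.
Unset Printing Implicit Defensive.

Import Order.TTheory GRing.Theory Num.Theory.
Import numFieldNormedType.Exports.

Local Open Scope classical_set_scope.
Local Open Scope ring_scope.

(* Weights are indexed from 0 instead of 1.  For k = 0 the value is 0. *)
Definition avg_pow (R : realType) (k : nat) (w : 'I_k -> R) (s : nat) : R :=
  (\sum_(i < k) w i ^+ s) / k%:R.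

Definition mutually_independent (R : realType) (d : measure_display)
    (T : measurableType d) (P : probability T R) (I : finType)
    (E : I -> set T) : Prop :=
  forall S : {set I},
    P (\bigcap_(e in [set e | e \in S]) E e) = (\prod_(e in S) P (E e))%E.

(* A bipartite graph with parts 'I_n and 'I_m is identified with its edge set,
   a subset of 'I_n * 'I_m. *)
Definition edge_event (T : Type) (n m : nat) (H : T -> {set 'I_n * 'I_m})
    (e : 'I_n * 'I_m) : set T := [set w | e \in H w].

Definition edge_prob (R : realType) (n m : nat) (y : 'I_n -> R) (x : 'I_m -> R)
    (mu : R) (e : 'I_n * 'I_m) : R :=
  (y e.1 * x e.2) / (y e.1 * x e.2 + mu).

Definition random_bipartite_graph (R : realType) (d : measure_display)
    (T : measurableType d) (P : probability T R) (n m : nat)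
    (y : 'I_n -> R) (x : 'I_m -> R) (mu : R)
    (H : T -> {set 'I_n * 'I_m}) : Prop :=
  [/\ forall e, measurable (edge_event H e),
      forall e, P (edge_event H e) = (edge_prob y x mu e)%:E
    & mutually_independent P (edge_event H)].

Definition affiliation_graph (n m : nat) (H : {set 'I_n * 'I_m}) : rel 'I_n :=
  fun i j => (i != j) && [exists u : 'I_m, ((i, u) \in H) && ((j, u) \in H)].

Definition degree (V : finType) (G : rel V) (v : V) : nat :=
  #|[pred w : V | G v w]|.

Definition num_triangles (V : finType) (G : rel V) : nat :=
  #|[pred A : {set V} | (#|A| == 3%N) &&
      [forall i in A, forall j in A, (i != j) ==> G i j]]|.

Definition num_2paths (V : finType) (G : rel V) : nat :=
  (\sum_(v : V) 'C(degree G v, 2))%N.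

Definition global_clustering (R : realType) (V : finType) (G : rel V) : R :=
  if num_triangles G == 0%N then 0
  else 3%:R * (num_triangles G)%:R / (num_2paths G)%:R.

(* Z = O_P(a): the sequence Z n / a n is tight. *)
Definition bigO_prob (R : realType) (d : nat -> measure_display)
    (T : forall n, measurableType (d n)) (P : forall n, probability (T n) R)
    (Z : forall n, T n -> R) (a : nat -> R) : Prop :=
  forall eps : R, 0 < eps -> exists K : R,
    forall n, (P n [set w | K < `|Z n w / a n|]%R <= eps%:E)%E.

(* Z = o_P(1). *)
Definition littleo1_prob (R : realType) (d : nat -> measure_display)
    (T : forall n, measurableType (d n)) (P : forall n, probability (T n) R)
    (Z : forall n, T n -> R) : Prop :=
  forall eps : R, 0 < eps ->
    P n [set w | eps < `|Z n w|] @[n --> \oo] --> 0%E.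

(* Main.v *)
(** The graph [H] is bipartite with [Theta(n)] edges, and the two counts of the
    affiliation graph are, up to errors with bounded mean, subgraph counts of
    [H].  Let [T] be the number of (ordered) claws of [H], i.e. of attributes
    [u] with three distinct neighbours, and let [Q] be the number of paths
    [j - u - v - w - k] of [H] with [u <> w], [j <> v] and [k <> v].  Six times
    the number of triangles differs from [T] only through pairs of claws on the
    same three vertices and through hexagons of [H]; twice the number of
    2-paths differs from [T + Q] only through 4-cycles of [H].

    The variance of a sum [F] of indicators of edge sets [s t] being present is
    the sum over [t] of [P(s t)] times the mean of [F (H + s t) - F H], since
    conditioning on [s t] being present amounts to adding [s t] to [H].  The
    increments are controlled by degrees in [H], and first and second moments
    of degrees suffice to bound both variances by [O(n)]: [T] needs the fifth
    moment of [x].  Replacing the edge probabilities by [y_i x_u / mu] costs [O(1)] in the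
    means, so both errors are [O(sqrt n)] in mean, and Markov's inequality
    concludes. *)
Require Import Defs.
From mathcomp Require Import all_boot all_order all_algebra.
From mathcomp Require Import all_classical all_reals all_analysis.
From mathcomp Require Import ring lra.
Set Implicit Arguments.
Unset Strict Implicit.
Unset Printing Implicit Defensive.
Import Order.TTheory GRing.Theory Num.Theory.
Import numFieldNormedType.Exports.
(* Restores the names that classical sets shadow. *)
Import boot.fintype boot.finset.
Local Open Scope ring_scope.

(** * Random subsets with independent elements *)

(** All estimates rest on one count of powers of [mu]. An edge costs a factor [1 / mu], and summing
    the weight factor of a vertex, raised to its degree in the pattern, gives at most [L * mu]; so a
    pattern with [v] vertices and [e] edges has mean of order at most [mu ^ (v - e)]. This is [mu]
    for claws and paths, which are trees, [1] for squares and hexagons, and [1 / mu] for twin claws.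
    A size-biased increment multiplies a pattern only by a constant and by further vertex factors,
    so a variance keeps the order [mu] of the tree at the price of higher moments. For 2-paths a
    square is not the whole error: replacing the adjacency at one end of a 2-path by a codegree
    leaves the codegree at the other end as a factor. This weighted count, [linked_squares], is
    treated by size bias as well. Everything is proved at fixed [n] with explicit constants, and
    limits enter only at the end. There the main terms have order [n * (A n + gamma_o * B n)], which
    may be much smaller than [n]; comparing it with [sqrt n] is exactly the divergence assumed for
    the clustering coefficient. *)

Section RandomSubset.
Context {R : realFieldType} {K : finType}.
Variables (q : {set K} -> R) (p : K -> R).

(** Up-set probabilities are what mutual independence of the edge events supplies directly, and they
    determine the law by inclusion-exclusion. Total mass 1 is the case of the empty set. *)
Definition inclusion_law :=
  (forall S, 0 <= q S) /\
  (forall A : {set K}, \sum_(S : {set K} | A \subset S) q S = \prod_(e in A) p e).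

Definition ind (S : {set K}) (e : K) : R := (e \in S)%:R.

Definition Ex (f : {set K} -> R) : R := \sum_S q S * f S.

Definition Qsum (I : finType) (P : pred I) (s : I -> seq K) (S : {set K}) : R :=
  \sum_(t | P t) \prod_(e <- s t) ind S e.

Lemma indE S e : ind S e = (e \in S)%:R. Proof. by []. Qed.

Lemma ind_ge0 S e : 0 <= ind S e. Proof. exact: ler0n. Qed.

Lemma ind_le1 S e : ind S e <= 1. Proof. by rewrite lern1 leq_b1. Qed.

Lemma indU1 e S e' : ind (e |: S) e' = if e' == e then 1 else ind S e'.
Proof. by rewrite /ind !inE; case: (e' == e). Qed.

Lemma ind_setU S s e : ind (S :|: [set:: s]) e = if e \in s then 1 else ind S e.
Proof. by rewrite /ind !inE; case: (e \in s); rewrite ?orbT ?orbF. Qed.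

Lemma prod_ind_ge0 (s : seq K) S : 0 <= \prod_(e <- s) ind S e.
Proof. by apply: prodr_ge0 => e _; exact: ind_ge0. Qed.

Lemma ExD f g : Ex (fun S => f S + g S) = Ex f + Ex g.
Proof. by rewrite /Ex -big_split; apply: eq_bigr => S _; rewrite mulrDr. Qed.

Lemma ExZ a f : Ex (fun S => a * f S) = a * Ex f.
Proof. by rewrite /Ex big_distrr; apply: eq_bigr => S _; rewrite mulrCA. Qed.

Lemma ExB f g : Ex (fun S => f S - g S) = Ex f - Ex g.
Proof. by rewrite /Ex -sumrB; apply: eq_bigr => S _; rewrite mulrBr. Qed.

Lemma Ex_sum (I : Type) (r : seq I) (P : pred I) (F : I -> {set K} -> R) :
  Ex (fun S => \sum_(i <- r | P i) F i S) = \sum_(i <- r | P i) Ex (F i).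
Proof.
rewrite /Ex exchange_big; apply: eq_bigr => S _; by rewrite big_distrr.
Qed.

Lemma eq_Ex f g : f =1 g -> Ex f = Ex g.
Proof. by move=> fg; apply: eq_bigr => S _; rewrite fg. Qed.

Hypothesis law : inclusion_law.

Lemma le_Ex f g : (forall S, f S <= g S) -> Ex f <= Ex g.
Proof. by move=> fg; apply: ler_sum => S _; rewrite ler_wpM2l ?law.1. Qed.

Lemma Ex_ge0 f : (forall S, 0 <= f S) -> 0 <= Ex f.
Proof. by move=> f0; apply: sumr_ge0 => S _; rewrite mulr_ge0 ?law.1. Qed.

Lemma incl_prob_ge0 e : 0 <= p e.
Proof.
by rewrite -(big_set1 *%R e p) -law.2 sumr_ge0 // => S _; rewrite law.1.
Qed.

Lemma Ex_cst a : Ex (fun=> a) = a.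
Proof.
rewrite /Ex -big_distrl /=.
rewrite (eq_bigl (fun S : {set K} => set0 \subset S)).
  by rewrite law.2 big_set0 mul1r.
by move=> S; rewrite sub0set.
Qed.

Lemma Ex_subset (A : {set K}) :
  Ex (fun S => (A \subset S)%:R) = \prod_(e in A) p e.
Proof.
rewrite -law.2 /Ex big_mkcond [RHS]big_mkcond.
by apply: eq_bigr => S _; case: ifP; rewrite ?mulr1 ?mulr0.
Qed.

(** Both sides equal the product of [p] over [e |: A]: if [e] lies in [A], the indicator is
    redundant on the left and only [A :\ e] is required on the right. *)
Lemma Ex_ind_subset e (A : {set K}) :
  Ex (fun S => ind S e * (A \subset S)%:R) =
  p e * Ex (fun S => (A \subset e |: S)%:R).
Proof.
have [eA | eNA] := boolP (e \in A).
- rewrite (eq_Ex (g := fun S => (A \subset S)%:R)); last first.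
    move=> S; rewrite /ind; case: (boolP (A \subset S)) => [/subsetP /(_ _ eA) ->|];
    by rewrite ?mulr1 ?mulr0.
  rewrite (eq_Ex (f := fun S => (A \subset e |: S)%:R)
                 (g := fun S => (A :\ e \subset S)%:R)); last first.
    by move=> S; rewrite subDset.
  by rewrite !Ex_subset (big_setD1 e).
rewrite (eq_Ex (g := fun S => (e |: A \subset S)%:R)); last first.
  by move=> S; rewrite subUset sub1set /ind -natrM mulnb.
rewrite Ex_subset big_setU1 //; congr (_ * _); rewrite -Ex_subset.
apply: eq_Ex => S; congr (_ _)%:R.
apply/idP/idP => [AS|/subsetP AS]; first exact: subset_trans AS (subsetUr _ _).
apply/subsetP => a aA; move: (AS a aA); rewrite !inE => /orP [/eqP ae|//].
by move: eNA; rewrite -ae aA.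
Qed.

(* Both sides are linear in [g], and the indicators of the up-sets
   [A \subset S] span all functions of [S]. *)
Lemma Ex_ind e g :
  Ex (fun S => ind S e * g S) = p e * Ex (fun S => g (e |: S)).
Proof.
pose D := fun g : {set K} -> R =>
  Ex (fun S => ind S e * g S) - p e * Ex (fun S => g (e |: S)).
have DE f h : f =1 h -> D f = D h.
  by move=> fh; rewrite /D; congr (_ - _ * _); apply: eq_Ex => S; rewrite fh.
have Dsum (I : finType) (P : pred I) (F : I -> {set K} -> R) :
    D (fun S => \sum_(i | P i) F i S) = \sum_(i | P i) D (F i).
  rewrite /D sumrB; congr (_ - _).
    by rewrite -Ex_sum; apply: eq_Ex => S; rewrite big_distrr.
  by rewrite Ex_sum big_distrr.
have DZ a f : D (fun S => a * f S) = a * D f.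
  rewrite /D mulrBr; congr (_ - _); last by rewrite ExZ mulrCA.
  by rewrite -ExZ; apply: eq_Ex => S; rewrite mulrCA.
have Dup (A : {set K}) : D (fun S => (A \subset S)%:R) = 0.
  by rewrite /D Ex_ind_subset subrr.
(* Moebius inversion by downward induction on [A]: the indicator of an up-set is the sum of the
   point masses of all supersets of [A], and the strict supersets have smaller complements. *)
have Ddelta k (A : {set K}) : (#|~: A| < k)%N -> D (fun S => (S == A)%:R) = 0.
  elim: k A => // k IH A; rewrite ltnS => kA.
  have: D (fun S => \sum_(B : {set K} | A \subset B) (S == B)%:R) = 0.
    rewrite -[RHS](Dup A); apply: DE => S.
    rewrite big_mkcond (bigD1 S) //= eqxx big1 ?addr0; first by case: ifP.
    by move=> B /negbTE BS; rewrite eq_sym BS if_same.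
  rewrite Dsum (bigD1 A) //= [X in _ + X]big1 ?addr0 // => B /andP [AB BA].
  apply: IH; apply: leq_trans kA; apply: proper_card.
  by rewrite properEneq setCS AB andbT (inj_eq (can_inj (@setCK _))).
apply/eqP; rewrite -subr_eq0 -/(D g); apply/eqP.
rewrite (DE _ (fun S => \sum_B g B * (S == B)%:R)); last first.
  move=> S; rewrite (bigD1 S) //= eqxx mulr1 big1 ?addr0 // => B /negbTE BS.
  by rewrite eq_sym BS mulr0.
rewrite Dsum big1 // => B _; rewrite DZ.
by rewrite (Ddelta (#|~: B|).+1) ?mulr0.
Qed.

Lemma Ex_prod (s : seq K) g : uniq s ->
  Ex (fun S => \prod_(e <- s) ind S e * g S) =
  \prod_(e <- s) p e * Ex (fun S => g (S :|: [set:: s])).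
Proof.
elim: s g => [|e s IH] g /=.
  move=> _; rewrite !big_nil mul1r; apply: eq_Ex => S; rewrite big_nil mul1r.
  by congr g; apply/setP => a; rewrite !inE orbF.
move=> /andP [es us]; rewrite big_cons -mulrA.
rewrite (eq_Ex (g := fun S => ind S e * (\prod_(e <- s) ind S e * g S))); last first.
  by move=> S; rewrite big_cons mulrA.
rewrite Ex_ind; congr (_ * _).
rewrite (eq_Ex (g := fun S => \prod_(e <- s) ind S e * g (e |: S))); last first.
  move=> S; congr (_ * _); apply: eq_big_seq => a aS.
  by rewrite indU1; case: eqP => // ae; rewrite -ae aS in es.
rewrite IH //; congr (_ * _); apply: eq_Ex => S; congr g.
by apply/setP => a; rewrite !inE orbCA orbA.
Qed.

Lemma Ex_prod1 (s : seq K) : uniq s ->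
  Ex (fun S => \prod_(e <- s) ind S e) = \prod_(e <- s) p e.
Proof.
move=> us; rewrite (eq_Ex (g := fun S => \prod_(e <- s) ind S e * 1)).
  by rewrite Ex_prod // Ex_cst mulr1.
by move=> S; rewrite mulr1.
Qed.

Lemma Ex_Qsum (I : finType) (P : pred I) (s : I -> seq K) :
  (forall t, P t -> uniq (s t)) ->
  Ex (Qsum P s) = \sum_(t | P t) \prod_(e <- s t) p e.
Proof.
by move=> us; rewrite Ex_sum; apply: eq_bigr => t Pt; rewrite Ex_prod1 ?us.
Qed.

(* Size bias: conditioning on [s t] being present amounts to adding it. *)
Lemma variance_Qsum (I : finType) (P : pred I) (s : I -> seq K) :
  (forall t, P t -> uniq (s t)) ->
  let Q := Qsum P s in
  Ex (fun S => (Q S - Ex Q) ^+ 2) =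
  \sum_(t | P t) \prod_(e <- s t) p e *
     Ex (fun S => Q (S :|: [set:: s t]) - Q S).
Proof.
move=> us Q; set M := Ex Q.
(* Since [Q - M] is centred, one factor of the square may be replaced by [Q] itself; only that
   factor is expanded into patterns, and each pattern then biases the other one. *)
transitivity (Ex (fun S => Q S * (Q S - M)) - M * Ex (fun S => Q S - M)).
  by rewrite -ExZ -ExB; apply: eq_Ex => S; rewrite expr2 mulrBl.
rewrite [Ex (fun S => Q S - M)]ExB Ex_cst subrr mulr0 subr0.
rewrite (eq_Ex (g := fun S => \sum_(t | P t) \prod_(e <- s t) ind S e * (Q S - M))).
  rewrite Ex_sum; apply: eq_bigr => t Pt; rewrite Ex_prod ?us //.
  by rewrite !ExB Ex_cst.
by move=> S; rewrite big_distrl.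
Qed.

End RandomSubset.

Arguments eq_Ex {R K q f g} _.

(** * Finite sums *)

Section FiniteSums.
Context {R : realFieldType}.

Lemma sum_triple (A B C : finType) (F : A * B * C -> R) :
  \sum_t F t = \sum_a \sum_b \sum_c F (a, b, c).
Proof.
rewrite pair_bigA pair_bigA /=; apply: eq_bigr => -[[a b] c] _ //.
Qed.

Lemma sum_quad (A B C D : finType) (F : A * B * C * D -> R) :
  \sum_t F t = \sum_a \sum_b \sum_c \sum_d F (a, b, c, d).
Proof.
rewrite pair_bigA pair_bigA pair_bigA /=.
by apply: eq_bigr => -[[[a b] c] d] _.
Qed.

Lemma sum_quint (A B C D E : finType) (F : A * B * C * D * E -> R) :
  \sum_t F t = \sum_a \sum_b \sum_c \sum_d \sum_e F (a, b, c, d, e).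
Proof.
rewrite pair_bigA pair_bigA pair_bigA pair_bigA /=.
by apply: eq_bigr => -[[[[a b] c] d] e] _.
Qed.

(** Nonnegativity is bundled with the bound because multiplying bounds needs both; iterating
    [nneg_sum_le_pair] produces the majorants for sums over tuples of vertices. *)
Definition nneg_sum_le (A : finType) (f : A -> R) (M : R) :=
  (forall a, 0 <= f a) /\ \sum_a f a <= M.

Lemma nneg_sum_le_pair (A B : finType) (f : A -> R) (g : B -> R) M N :
  nneg_sum_le f M -> nneg_sum_le g N ->
  nneg_sum_le (fun t : A * B => f t.1 * g t.2) (M * N).
Proof.
move=> [f0 fM] [g0 gN]; split=> [t|]; first exact: mulr_ge0.
rewrite -(pair_bigA _ (fun a b => f a * g b)) /=.
under eq_bigr do rewrite -big_distrr.
by rewrite -big_distrl ler_pM ?sumr_ge0.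
Qed.

Lemma sum_le_nneg (A : finType) (P : pred A) (F f : A -> R) (C M : R) :
  0 <= C -> nneg_sum_le f M -> (forall t, P t -> F t <= C * f t) ->
  \sum_(t | P t) F t <= C * M.
Proof.
move=> C0 [f0 fM] Ff; apply: (@le_trans _ _ (C * \sum_t f t)); last first.
  by rewrite ler_wpM2l.
rewrite big_distrr /= [leLHS]big_mkcond; apply: ler_sum => t _.
by case: ifP => [/Ff//|_]; rewrite mulr_ge0.
Qed.

(** Meant for tuples with a coincidence: [h] repeats an entry of a shorter tuple, so the sum loses
    one index. Surjectivity is enough, since extra preimages only add nonnegative terms. *)
Lemma sum_le_onto (A B : finType) (h : B -> A) (P : pred A) (F : A -> R) :
  (forall t, 0 <= F t) -> (forall t, P t -> exists s, h s = t) ->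
  \sum_(t | P t) F t <= \sum_s F (h s).
Proof.
move=> F0 hP; rewrite [leRHS](partition_big h predT) //= [leLHS]big_mkcond.
apply: ler_sum => t _; case: ifP => [/hP [s hs]|_]; last exact: sumr_ge0.
by rewrite (bigD1 s) ?hs //= lerDl sumr_ge0.
Qed.

Lemma sum_cube (A : finType) (f : A -> R) :
  \sum_i \sum_j \sum_k f i * f j * f k = (\sum_i f i) ^+ 3.
Proof.
rewrite !exprS expr0 mulr1 big_distrl; apply: eq_bigr => i _.
rewrite /= big_distrl big_distrr; apply: eq_bigr => j _ /=.
by rewrite mulrA big_distrr.
Qed.

Lemma sum_eq_nat1 (A : finType) (a : A) : \sum_i (i == a)%:R = 1 :> R.
Proof.
by rewrite (bigD1 a) //= eqxx big1 ?addr0 // => i /negbTE ->.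
Qed.

Lemma sum_eq_natM (A : finType) (a : A) (g : A -> R) :
  \sum_i (i == a)%:R * g i = g a.
Proof.
rewrite (bigD1 a) //= eqxx mul1r big1 ?addr0 // => i /negbTE ->.
by rewrite mul0r.
Qed.

Lemma sum_off_diag (A : finType) (f : A -> R) :
  \sum_u \sum_(w | w != u) f u * f w = (\sum_u f u) ^+ 2 - \sum_u f u ^+ 2.
Proof.
rewrite expr2 big_distrl -sumrB; apply: eq_bigr => u _.
by rewrite /= [in RHS](bigD1 u) //= mulrDr expr2 addrC addKr big_distrr.
Qed.

(** An off-diagonal sum is a square minus a sum of squares, so changing two entries changes it by an
    explicit polynomial. Adding a path to the graph changes exactly such a pair of columns. *)
Lemma sum_off_diag_perturb (A : finType) (f g : A -> R) (u w : A) : u != w ->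
  (forall a, a != u -> a != w -> g a = f a) ->
  \sum_a \sum_(b | b != a) g a * g b - \sum_a \sum_(b | b != a) f a * f b =
  2 * ((g u - f u) * (\sum_(b | b != u) f b) +
       (g w - f w) * (\sum_(b | b != w) f b) + (g u - f u) * (g w - f w)).
Proof.
move=> uw gf; rewrite !sum_off_diag.
have wu : w != u by rewrite eq_sym.
rewrite !(bigD1 w wu) !(bigD1 u (isT : predT u)) !(bigD1 w wu) /=.
rewrite [\sum_(b | b != w) _](bigD1 u uw) /=.
rewrite (eq_bigr (F1 := g) f); last by move=> a /andP [au aw]; apply: gf.
rewrite (eq_bigr (F1 := fun a => g a ^+ 2) (fun a => f a ^+ 2)); last first.
  by move=> a /andP [au aw]; rewrite gf.
rewrite (eq_bigl (P1 := fun i => (i != w) && (i != u))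
           (fun i => (i != u) && (i != w))); last by move=> i; rewrite andbC.
set s := \sum_(i | _) f i; set s2 := \sum_(i | _) _.
by ring.
Qed.

End FiniteSums.

(** * Subgraph counts of a sparse random bipartite graph *)

Section BipartiteMoments.
Context {R : realFieldType} {n m : nat}.
Local Notation K := ('I_n * 'I_m)%type.
Variables (q : {set K} -> R) (p : K -> R).
Variables (y : 'I_n -> R) (x : 'I_m -> R) (mu L : R).

Definition edge_weight (e : K) : R := y e.1 * x e.2 / mu.
(* With [1 +], both factors are at least 1, so exponents of vertex factors may
   be raised freely in upper bounds. *)
Definition edge_bound (e : K) : R := (1 + y e.1) * (1 + x e.2) / mu.

(** One constant [L] absorbs both moment bounds and the ratio of the two part sizes, which leaves
    [mu] as the only scale. *)
Definition sparse_weights :=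
  [/\ 1 <= mu, 1 <= L, (forall i, 0 <= y i), (forall u, 0 <= x u)
    & \sum_i (1 + y i) ^+ 4 <= L * mu /\ \sum_u (1 + x u) ^+ 5 <= L * mu].

(** The gap is quadratic, so replacing a probability by its weight costs a further factor [1 / mu];
    on a tree pattern, whose count has order [mu], this leaves [O(1)]. *)
Definition sparse_probs :=
  forall e, p e <= edge_weight e /\ edge_weight e - p e <= edge_weight e ^+ 2.

Definition deg (S : {set K}) (u : 'I_m) : R := \sum_i ind S (i, u).
Definition mean_deg (u : 'I_m) : R := \sum_i p (i, u).
(** Independence from the edges at [u], phrased as invariance under adding them: this is the form in
    which size bias removes the indicator of such an edge. *)
Definition column_free (u : 'I_m) (W : {set K} -> R) :=
  forall S i, W ((i, u) |: S) = W S.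

Lemma deg_ge0 S u : 0 <= deg S u.
Proof. by apply: sumr_ge0 => i _; apply: ind_ge0. Qed.

Hypothesis law : inclusion_law q p.
Hypothesis wts : sparse_weights.
Hypothesis prb : sparse_probs.

Local Notation Ex := (Ex q).
Local Notation Y i := (1 + y i).
Local Notation X u := (1 + x u).

Let eqle (a b : R) : a = b -> a <= b. Proof. by move=> ->. Qed.
Let p0 e : 0 <= p e := incl_prob_ge0 law e.
Let y0 i : 0 <= y i. Proof. by case: wts. Qed.
Let x0 u : 0 <= x u. Proof. by case: wts. Qed.
Let mu1 : 1 <= mu. Proof. by case: wts. Qed.
Let mu0 : 0 < mu. Proof. exact: lt_le_trans mu1. Qed.
Let L1 : 1 <= L. Proof. by case: wts. Qed.
Let L0 : 0 <= L. Proof. exact: le_trans L1. Qed.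
Let Y1 i : 1 <= Y i. Proof. by rewrite lerDl. Qed.
Let X1 u : 1 <= X u. Proof. by rewrite lerDl. Qed.
Let Y0 i : 0 <= Y i. Proof. exact: le_trans (Y1 i). Qed.
Let X0 u : 0 <= X u. Proof. exact: le_trans (X1 u). Qed.

Lemma edge_weight_ge0 e : 0 <= edge_weight e.
Proof. by rewrite divr_ge0 ?mulr_ge0 // ltW. Qed.

Lemma edge_weight_le e : edge_weight e <= edge_bound e.
Proof.
by rewrite ler_pM2r ?invr_gt0 // ler_pM // lerDr.
Qed.

Lemma edge_bound_ge0 e : 0 <= edge_bound e.
Proof. exact: le_trans (edge_weight_ge0 e) (edge_weight_le e). Qed.

Lemma prob_le_bound e : p e <= edge_bound e.
Proof. by have [pa _] := prb e; apply: le_trans pa (edge_weight_le e). Qed.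

Lemma prod_prob_le s : \prod_(e <- s) p e <= \prod_(e <- s) edge_bound e.
Proof. by apply: ler_prod => e _; rewrite p0 prob_le_bound. Qed.

Lemma prod_weight_le s :
  \prod_(e <- s) edge_weight e <= \prod_(e <- s) edge_bound e.
Proof. by apply: ler_prod => e _; rewrite edge_weight_ge0 edge_weight_le. Qed.

Lemma prod_weight_ge0 s : 0 <= \prod_(e <- s) edge_weight e.
Proof. by apply: prodr_ge0 => e _; apply: edge_weight_ge0. Qed.

Lemma prod_bound_ge0 s : 0 <= \prod_(e <- s) edge_bound e.
Proof. by apply: prodr_ge0 => e _; apply: edge_bound_ge0. Qed.

(** Telescoping: the edges are exchanged one at a time, and each exchange costs one more factor of
    the weight of that edge. *)
Lemma prod_weight_sub_prob s :
  0 <= \prod_(e <- s) edge_weight e - \prod_(e <- s) p e <=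
  (\sum_(e <- s) edge_bound e) * \prod_(e <- s) edge_bound e.
Proof.
apply/andP; split.
  by rewrite subr_ge0; apply: ler_prod => e _; rewrite p0 (prb e).1.
apply: (@le_trans _ _
  ((\sum_(e <- s) edge_weight e) * \prod_(e <- s) edge_weight e)); last first.
  rewrite ler_pM ?prod_weight_ge0 ?prod_weight_le //.
    by apply: sumr_ge0 => e _; apply: edge_weight_ge0.
  by apply: ler_sum => e _; apply: edge_weight_le.
elim: s => [|e s IH]; first by rewrite !big_nil subrr mul0r.
rewrite !big_cons; have [pa pa2] := prb e.
have := prod_weight_ge0 s; have := edge_weight_ge0 e.
set a := edge_weight e in pa pa2 *; set A := \prod_(e <- s) _ in IH *.
set B := \prod_(e <- s) _ in IH *; set s1 := \sum_(e <- s) _ in IH *.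
move=> a0 A0.
have -> : a * A - p e * B = (a - p e) * A + p e * (A - B) by ring.
rewrite [leRHS](_ : _ = a ^+ 2 * A + a * (s1 * A)); last by ring.
apply: lerD; first by rewrite ler_wpM2r.
apply: (@le_trans _ _ (p e * (s1 * A))); first by rewrite ler_wpM2l.
rewrite ler_wpM2r // mulr_ge0 //.
by apply: sumr_ge0 => ? _; apply: edge_weight_ge0.
Qed.

Lemma sumY k : (k <= 4)%N -> nneg_sum_le (fun i => Y i ^+ k) (L * mu).
Proof.
move=> k4; split=> [i|]; first exact: exprn_ge0.
case: wts => _ _ _ _ [Ysum _]; apply: le_trans Ysum.
by apply: ler_sum => i _; apply: ler_weXn2l.
Qed.

Lemma sumX k : (k <= 5)%N -> nneg_sum_le (fun u => X u ^+ k) (L * mu).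
Proof.
move=> k5; split=> [i|]; first exact: exprn_ge0.
case: wts => _ _ _ _ [_ Xsum]; apply: le_trans Xsum.
by apply: ler_sum => u _; apply: ler_weXn2l.
Qed.

Lemma mean_deg_ge0 u : 0 <= mean_deg u.
Proof. by apply: sumr_ge0. Qed.

Lemma mean_deg_le u : mean_deg u <= L * X u.
Proof.
apply: (@le_trans _ _ (X u / mu * (L * mu))).
  have X0mu : 0 <= X u / mu by rewrite divr_ge0 // ltW.
  apply: (sum_le_nneg X0mu (@sumY 1 isT)) => i _.
  by apply: le_trans (prob_le_bound _) _; apply: eqle; rewrite /edge_bound /=; ring.
apply: eqle; field.
by rewrite gt_eqF.
Qed.

Lemma mean_deg1_le u : 1 + mean_deg u <= 2 * L * X u.
Proof.
have := mean_deg_le u; have : 1 <= L * X u by rewrite mulr_ege1.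
by lra.
Qed.

Lemma Ex_ind_free i u W : column_free u W ->
  Ex (fun S => ind S (i, u) * W S) = p (i, u) * Ex W.
Proof.
by move=> uW; rewrite (Ex_ind law); congr (_ * _); apply: eq_Ex => S.
Qed.

Lemma Ex_deg u W : column_free u W ->
  Ex (fun S => deg S u * W S) = mean_deg u * Ex W.
Proof.
move=> uW; rewrite big_distrl /= -(eq_bigr _ (fun i _ => Ex_ind_free i uW)).
by rewrite -Ex_sum; apply: eq_Ex => S; rewrite big_distrl.
Qed.

Lemma Ex_deg1 u W : column_free u W ->
  Ex (fun S => (1 + deg S u) * W S) = (1 + mean_deg u) * Ex W.
Proof.
move=> uW; rewrite mulrDl mul1r -Ex_deg // -ExD.
by apply: eq_Ex => S; rewrite mulrDl mul1r.
Qed.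

Lemma Ex_deg1_le u W : (forall S, 0 <= W S) -> column_free u W ->
  Ex (fun S => (1 + deg S u) * W S) <= 2 * L * X u * Ex W.
Proof.
by move=> W0 uW; rewrite Ex_deg1 // ler_wpM2r ?mean_deg1_le ?(Ex_ge0 law).
Qed.

Lemma degU1 S i u u' : deg ((i, u) |: S) u' <= deg S u' + (u' == u)%:R.
Proof.
have [->|uu'] := eqVneq u' u; last first.
  rewrite addr0; apply: ler_sum => j _; rewrite indU1; case: eqP => // -[_ /eqP].
  by rewrite (negbTE uu').
rewrite -(sum_eq_nat1 i) -big_split; apply: ler_sum => j _.
rewrite indU1 xpair_eqE eqxx andbT; by case: (j == i); rewrite /= ?addr0 ?lerDr ?ind_ge0.
Qed.

(** Adding one edge at [u] raises its degree by at most 1, so size bias bounds the second moment by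
    [l * (1 + l)] for mean degree [l]. The factor 8 comes from [1 + 2 * l + l * (1 + l) <= 2 * (1 +
    l) ^+ 2] and [1 + l <= 2 * L * X u]. *)
Lemma Ex_deg1_sqr u : Ex (fun S => (1 + deg S u) ^+ 2) <= 8 * L ^+ 2 * X u ^+ 2.
Proof.
have cst1 : column_free u (fun=> 1) by [].
have M1 : Ex (fun S => deg S u) = mean_deg u.
  transitivity (mean_deg u * Ex (fun=> 1)); last by rewrite (Ex_cst law) mulr1.
  rewrite -Ex_deg //.
  by apply: eq_Ex => S; rewrite mulr1.
have M2 : Ex (fun S => deg S u ^+ 2) <= mean_deg u * (1 + mean_deg u).
  rewrite (eq_Ex (g := fun S => \sum_i ind S (i, u) * deg S u)); last first.
    by move=> S; rewrite expr2 {1}/deg big_distrl.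
  rewrite Ex_sum [leRHS]big_distrl /=; apply: ler_sum => i _.
  rewrite (Ex_ind law) ler_wpM2l // -[Z in Z + _](Ex_cst law 1) -{1}M1 -ExD.
  by apply: (le_Ex law) => S; have := degU1 S i u u; rewrite eqxx addrC.
rewrite (eq_Ex (g := fun S => 1 + 2 * deg S u + deg S u ^+ 2)); last first.
  by move=> S; ring.
rewrite !ExD ExZ (Ex_cst law) M1.
have := mean_deg1_le u; have := mean_deg_ge0 u; move: M2.
set M := Ex _; set l := mean_deg u => M2 l0 l1.
have : (1 + l) ^+ 2 <= (2 * L * X u) ^+ 2.
  by rewrite ler_pXn2r // nnegrE ?mulr_ge0 //; lra.
rewrite (_ : (2 * L * X u) ^+ 2 = 4 * (L ^+ 2 * X u ^+ 2)); last by ring.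
rewrite (_ : 8 * L ^+ 2 * X u ^+ 2 = 8 * (L ^+ 2 * X u ^+ 2)); last by ring.
set z := L ^+ 2 * _ => lz.
suff : 1 + 2 * l + l * (1 + l) <= 2 * (1 + l) ^+ 2 by lra.
by rewrite -subr_ge0 (_ : _ - _ = 1 + l + l ^+ 2); [rewrite !addr_ge0 ?sqr_ge0|ring].
Qed.

(** * Claws and paths: increments and variances *)

Definition claw (t : 'I_m * 'I_n * 'I_n * 'I_n) : seq K :=
  let: (u, i, j, k) := t in [:: (i, u); (j, u); (k, u)].
Definition claw_ok (t : 'I_m * 'I_n * 'I_n * 'I_n) : bool :=
  let: (u, i, j, k) := t in [&& i != j, i != k & j != k].
Definition claws (S : {set K}) : R := Qsum claw_ok claw S.

(* The path [j - u - v - w - k]. *)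
Definition wpath (t : 'I_m * 'I_m * 'I_n * 'I_n * 'I_n) : seq K :=
  let: (u, w, v, j, k) := t in [:: (v, u); (j, u); (v, w); (k, w)].
Definition wpath_ok (t : 'I_m * 'I_m * 'I_n * 'I_n * 'I_n) : bool :=
  let: (u, w, v, j, k) := t in [&& w != u, j != v & k != v].
Definition wpaths (S : {set K}) : R := Qsum wpath_ok wpath S.

Lemma claw_uniq t : claw_ok t -> uniq (claw t).
Proof.
case: t => [[[u i] j] k] /and3P [ij ik jk].
by rewrite /= !inE !xpair_eqE !eqxx !andbT negb_or ij ik jk.
Qed.

Lemma wpath_uniq t : wpath_ok t -> uniq (wpath t).
Proof.
case: t => [[[[u w] v] j] k] /and3P [wu jv kv].
rewrite /= !inE !xpair_eqE !eqxx !andbT /= [u == w]eq_sym (negbTE wu).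
by rewrite !andbF /= !orbF eq_sym jv eq_sym kv.
Qed.

(** Only claws centred at [u] are created, and the degree [d] of [u] grows by at most 3; counting
    triples with repetition gives [(d + 3) ^+ 3 - d ^+ 3 <= 27 * (1 + d) ^+ 2]. *)
Lemma claws_incr t S :
  claws (S :|: [set:: claw t]) - claws S <=
  27 * (1 + deg S t.1.1.1) ^+ 2.
Proof.
case: t => [[[u i] j] k] /=; set S' := S :|: _.
pose al (l : 'I_n) : R := (l == i)%:R + (l == j)%:R + (l == k)%:R.
have al0 l : 0 <= al l by rewrite !addr_ge0.
have indS' l : ind S' (l, u) <= ind S (l, u) + al l.
  rewrite ind_setU /al !inE !xpair_eqE eqxx !andbT; have := ind_ge0 (R := R) S (l, u).
  by case: (l == i); case: (l == j); case: (l == k); rewrite /= ?mulr1n ?mulr0n; lra.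
have indS l u' : u' != u -> ind S' (l, u') = ind S (l, u') :> R.
  by move=> u'u; rewrite ind_setU !inE !xpair_eqE (negbTE u'u) !andbF.
pose I l : R := ind S (l, u).
have I0 l : 0 <= I l by apply: ind_ge0.
rewrite /claws /Qsum -sumrB.
(* The distinctness condition is dropped so that the sum factorizes; the added terms are nonnegative
   because every indicator only grows. *)
apply: (@le_trans _ _ (\sum_(t : 'I_m * 'I_n * 'I_n * 'I_n)
  (t.1.1.1 == u)%:R * ((I t.1.1.2 + al t.1.1.2) * (I t.1.2 + al t.1.2) *
     (I t.2 + al t.2) - I t.1.1.2 * I t.1.2 * I t.2))).
  rewrite big_mkcond; apply: ler_sum => -[[[u' i'] j'] k'] _ /=.
  have [->|u'u] := eqVneq u' u; last first.
    by rewrite mul0r !big_cons !big_nil !indS // subrr if_same.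
  rewrite mul1r !big_cons !big_nil !mulr1 !mulrA.
  have le3 (a b c a' b' c' : R) : 0 <= a -> 0 <= b -> 0 <= c -> a <= a' -> b <= b' ->
     c <= c' -> a * b * c <= a' * b' * c'.
    by move=> *; rewrite ler_pM ?mulr_ge0 // ler_pM.
  case: ifP => _.
    by rewrite lerB // le3 ?ind_ge0 ?indS'.
  by rewrite subr_ge0 le3 // lerDl.
rewrite sum_quad.
under eq_bigr do under eq_bigr do under eq_bigr do rewrite -big_distrr.
under eq_bigr do under eq_bigr do rewrite -big_distrr.
under eq_bigr do rewrite -big_distrr.
rewrite /= sum_eq_natM.
rewrite (_ : \sum_a \sum_b \sum_c _ = (deg S u + 3) ^+ 3 - deg S u ^+ 3).
  have := deg_ge0 S u; set d := deg S u => d0.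
  rewrite -subr_ge0 (_ : _ - _ = 18 * d ^+ 2 + 27 * d); last by ring.
  by rewrite addr_ge0 ?mulr_ge0 ?sqr_ge0.
have -> : deg S u + 3 = \sum_l (I l + al l).
  by rewrite !big_split /= !sum_eq_nat1 /deg; ring.
rewrite -!sum_cube -sumrB; apply: eq_bigr => a _; rewrite -sumrB.
by apply: eq_bigr => b _; rewrite -sumrB.
Qed.

Lemma prod3_bound u i j k :
  \prod_(e <- claw (u, i, j, k)) edge_bound e =
  Y i * Y j * Y k * X u ^+ 3 / mu ^+ 3.
Proof. by rewrite !big_cons big_nil /edge_bound /=; field; rewrite gt_eqF. Qed.

Lemma prod4_bound u w v j k :
  \prod_(e <- wpath (u, w, v, j, k)) edge_bound e =
  Y v ^+ 2 * Y j * Y k * X u ^+ 2 * X w ^+ 2 / mu ^+ 4.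
Proof. by rewrite !big_cons big_nil /edge_bound /=; field; rewrite gt_eqF. Qed.

(** The centre carries [X u ^+ 3] from the claw and [X u ^+ 2] from the squared degree in the
    increment, hence the fifth moment. The constant is [27 * 8]; four vertex sums over three edges
    leave one [mu]. *)
Lemma claws_variance :
  Ex (fun S => (claws S - Ex claws) ^+ 2) <= 216 * L ^+ 6 * mu.
Proof.
rewrite (variance_Qsum law claw_uniq) -/claws.
have C0 : 0 <= 216 * L ^+ 2 / mu ^+ 3.
  by rewrite divr_ge0 ?mulr_ge0 ?exprn_ge0 // ltW.
have W := nneg_sum_le_pair (nneg_sum_le_pair (nneg_sum_le_pair
  (@sumX 5 isT) (@sumY 1 isT)) (@sumY 1 isT)) (@sumY 1 isT).
apply: le_trans (sum_le_nneg C0 W _) _; last first.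
  apply: eqle; field.
  by rewrite gt_eqF.
move=> [[[u i] j] k] ok /=.
apply: (@le_trans _ _ (\prod_(e <- claw (u, i, j, k)) edge_bound e *
    (27 * (8 * L ^+ 2 * X u ^+ 2)))); last first.
  rewrite prod3_bound; apply: eqle; field.
  by rewrite gt_eqF.
apply: (@le_trans _ _ (\prod_(e <- claw (u, i, j, k)) p e *
    (27 * (8 * L ^+ 2 * X u ^+ 2)))); last first.
  rewrite ler_wpM2r ?prod_prob_le //.
  by rewrite !mulr_ge0 ?sqr_ge0.
rewrite ler_wpM2l ?prodr_ge0 //.
apply: (@le_trans _ _ (27 * Ex (fun S => (1 + deg S u) ^+ 2))).
  by rewrite -ExZ; apply: (le_Ex law) => S; apply: (claws_incr (u, i, j, k)).
by rewrite ler_wpM2l ?Ex_deg1_sqr.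
Qed.

Local Notation ind := (@ind R _).

(** One half of a path cut at its middle vertex [v]. The two halves use different columns, so they
    depend on disjoint sets of edges. *)
Definition cherries (S : {set K}) (u : 'I_m) (v : 'I_n) : R :=
  \sum_(j | j != v) ind S (v, u) * ind S (j, u).
(** Leaving out column [u] makes this independent of the edges at [u], so its mean factors out
    against degrees and indicators of that column. *)
Definition cherries_off (S : {set K}) (u : 'I_m) (v : 'I_n) : R :=
  \sum_(w | w != u) cherries S w v.

Lemma cherries_ge0 S u v : 0 <= cherries S u v.
Proof. by apply: sumr_ge0 => j _; rewrite mulr_ge0 ?ind_ge0. Qed.

Lemma cherries_off_ge0 S u v : 0 <= cherries_off S u v.
Proof. by apply: sumr_ge0 => w _; apply: cherries_ge0. Qed.

Lemma cherries_off_free u v : column_free u (fun S => cherries_off S u v).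
Proof.
move=> S i; apply: eq_bigr => w wu; apply: eq_bigr => j _.
by rewrite !indU1 !xpair_eqE (negbTE wu) !andbF.
Qed.

Lemma wpathsE S :
  wpaths S = \sum_v \sum_u \sum_(w | w != u) cherries S u v * cherries S w v.
Proof.
rewrite exchange_big /wpaths /Qsum big_mkcond sum_quint /=.
apply: eq_bigr => u _; rewrite [RHS]exchange_big /= [RHS]big_mkcond.
apply: eq_bigr => w _; case: ifP => wu /=; last by rewrite !big1 // => *; rewrite !big1.
apply: eq_bigr => v _; rewrite big_distrl [RHS]big_mkcond.
apply: eq_bigr => j _ /=; case: ifP => jv; last by rewrite big1.
rewrite big_distrr [RHS]big_mkcond; apply: eq_bigr => k _ /=; case: ifP => // kv.
by rewrite !big_cons big_nil; ring.
Qed.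

Lemma Ex_cherries u v : Ex (fun S => cherries S u v) <= Y v * X u ^+ 2 * L / mu.
Proof.
rewrite Ex_sum; apply: (@le_trans _ _ (\sum_i p (v, u) * p (i, u))).
  rewrite [leLHS]big_mkcond; apply: ler_sum => i _; case: ifP => iv; last exact: mulr_ge0.
  have /(Ex_prod1 law) : uniq [:: (v, u); (i, u)].
    by rewrite /= inE xpair_eqE eqxx !andbT eq_sym.
  rewrite !big_cons big_nil mulr1 => <-; apply: (le_Ex law) => S.
  by rewrite !big_cons big_nil mulr1.
rewrite -big_distrr /= -/(mean_deg u).
apply: (@le_trans _ _ (edge_bound (v, u) * (L * X u))).
  by rewrite ler_pM ?p0 ?mean_deg_ge0 ?mean_deg_le ?prob_le_bound.
by apply: eqle; rewrite /edge_bound /=; ring.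
Qed.

Lemma Ex_cherries_off u v : Ex (fun S => cherries_off S u v) <= L ^+ 2 * Y v.
Proof.
rewrite Ex_sum; have C0 : 0 <= Y v * L / mu by rewrite divr_ge0 ?mulr_ge0 // ltW.
apply: le_trans (sum_le_nneg C0 (@sumX 2 isT) _) _; last first.
  by apply: eqle; field; rewrite gt_eqF.
by move=> w _; apply: le_trans (Ex_cherries _ _) _; apply: eqle; ring.
Qed.

(** Column [u] gains at most the edges at [a] and [b], so its degree grows by at most 2 and the
    bound is the expansion of a product of two enlarged factors. Nonnegativity is kept because
    [wpaths_incr] multiplies two such increments. *)
Lemma cherries_incr (S S' : {set K}) u v a b : 
  (forall l, ind S (l, u) <= ind S' (l, u) <=
     ind S (l, u) + ((l == a)%:R + (l == b)%:R : R)) ->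
  0 <= cherries S' u v - cherries S u v <=
    ((v == a)%:R + (v == b)%:R) * (deg S u + 2) + 2 * ind S (v, u).
Proof.
pose al l : R := (l == a)%:R + (l == b)%:R => indS'.
rewrite -sumrB; apply/andP; split.
  apply: sumr_ge0 => j _; rewrite subr_ge0.
  by have /andP [? _] := indS' v; have /andP [? _] := indS' j;
    rewrite ler_pM ?ind_ge0.
have al0 l : 0 <= al l by rewrite addr_ge0.
apply: (@le_trans _ _ (\sum_j ((ind S (v, u) + al v) * (ind S (j, u) + al j) -
   ind S (v, u) * ind S (j, u)))).
  rewrite [leLHS]big_mkcond; apply: ler_sum => j _; case: ifP => _.
    have /andP [? ?] := indS' v; have /andP [? ?] := indS' j.
    by rewrite lerB // ler_pM ?ind_ge0.
  by rewrite subr_ge0 ler_pM ?ind_ge0 // lerDl.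
rewrite sumrB -!big_distrr /= !big_split /= !sum_eq_nat1 -/(deg S u) -/(al v).
by apply: eqle; ring.
Qed.

(** Only columns [u] and [w] change. The first two lines bound the new half-paths in column [u]
    completed by old ones elsewhere, the next two do the same for [w], and the last bounds paths
    that are new in both columns. *)
Lemma wpaths_incr u w v j k S : wpath_ok (u, w, v, j, k) ->
  wpaths (S :|: [set:: wpath (u, w, v, j, k)]) - wpaths S <=
  4 * ((1 + deg S u) * (cherries_off S u v + cherries_off S u j)) +
  4 * \sum_l ind S (l, u) * cherries_off S u l +
  4 * ((1 + deg S w) * (cherries_off S w v + cherries_off S w k)) +
  4 * \sum_l ind S (l, w) * cherries_off S w l +
  48 * ((1 + deg S u) * (1 + deg S w)).
Proof.
move=> /and3P [wu jv kv]; set S' := S :|: _.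
have uw : u != w by rewrite eq_sym.
have indu l : ind S (l, u) <= ind S' (l, u) <=
    ind S (l, u) + ((l == v)%:R + (l == j)%:R : R).
  rewrite ind_setU !inE !xpair_eqE !eqxx !andbT (negbTE uw) !andbF !orbF.
  have := ind_ge0 (R := R) S (l, u); have := ind_le1 (R := R) S (l, u).
  by case: (l == v); case: (l == j); rewrite /= ?mulr1n ?mulr0n => *; lra.
have indw l : ind S (l, w) <= ind S' (l, w) <=
    ind S (l, w) + ((l == v)%:R + (l == k)%:R : R).
  rewrite ind_setU !inE !xpair_eqE !eqxx !andbT (negbTE wu) !andbF /=.
  have := ind_ge0 (R := R) S (l, w); have := ind_le1 (R := R) S (l, w).
  by case: (l == v); case: (l == k); rewrite /= ?mulr1n ?mulr0n => *; lra.
have indo l a : a != u -> a != w -> ind S' (l, a) = ind S (l, a) :> R.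
  move=> /negbTE au /negbTE aw.
  by rewrite ind_setU !inE !xpair_eqE au aw !andbF.
pose du l := cherries S' u l - cherries S u l.
pose dw l := cherries S' w l - cherries S w l.
rewrite !wpathsE -sumrB.
rewrite (eq_bigr (fun l => 2 * (du l * cherries_off S u l + dw l * cherries_off S w l +
    du l * dw l))); last first.
  move=> l _; rewrite (sum_off_diag_perturb (u := u) (w := w)
    (f := fun a => cherries S a l) (g := fun a => cherries S' a l)) // => a au aw.
  by apply: eq_bigr => i _; rewrite !indo.
rewrite -big_distrr !big_split /=.
have part a b c (d := fun l => cherries S' a l - cherries S a l) :
    (forall l, ind S (l, a) <= ind S' (l, a) <=
       ind S (l, a) + ((l == b)%:R + (l == c)%:R : R)) ->
    \sum_l d l * cherries_off S a l <=
    2 * ((1 + deg S a) * (cherries_off S a b + cherries_off S a c)) +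
    2 * \sum_l ind S (l, a) * cherries_off S a l.
  move=> ha; apply: (@le_trans _ _ (\sum_l
     (((l == b)%:R + (l == c)%:R) * (deg S a + 2) + 2 * ind S (l, a)) *
       cherries_off S a l)).
    apply: ler_sum => l _; rewrite ler_wpM2r ?cherries_off_ge0 //.
    by have /andP [] := cherries_incr l ha.
  rewrite (eq_bigr (fun l => (deg S a + 2) * ((l == b)%:R * cherries_off S a l) +
     (deg S a + 2) * ((l == c)%:R * cherries_off S a l) +
     2 * (ind S (l, a) * cherries_off S a l))); last by move=> l _; ring.
  rewrite !big_split -!big_distrr /= !sum_eq_natM lerD2r -mulrDr mulrA.
  rewrite ler_wpM2r ?addr_ge0 ?cherries_off_ge0 //.
  by have := deg_ge0 S a; lra.
have pu := part _ _ _ indu; have pw := part _ _ _ indw.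
(* Each [dw l] is at most [2 * (deg + 2) + 2 <= 6 * (1 + deg)] for the degree of [w], while the
   [du l] sum to at most [4 * (1 + deg)] for that of [u]. *)
have puw : \sum_l du l * dw l <= 24 * ((1 + deg S u) * (1 + deg S w)).
  apply: (@le_trans _ _ (\sum_l du l * (6 * (1 + deg S w)))).
    apply: ler_sum => l _; have /andP [du0 _] := cherries_incr l indu.
    rewrite ler_wpM2l //; have /andP [_] := cherries_incr l indw.
    move/le_trans; apply; have := ind_le1 (R := R) S (l, w).
    have := deg_ge0 S w.
    by case: (l == v); case: (l == k); rewrite /= ?mulr1n ?mulr0n => *; lra.
  rewrite -big_distrl /=.
  rewrite (_ : 24 * _ = (4 * (1 + deg S u)) * (6 * (1 + deg S w))); last by ring.
  have := deg_ge0 S w; have := deg_ge0 S u => d0 d1.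
  rewrite ler_wpM2r ?mulr_ge0 ?addr_ge0 //.
  apply: (@le_trans _ _ (\sum_l (((l == v)%:R + (l == j)%:R) * (deg S u + 2) +
       2 * ind S (l, u)))).
    by apply: ler_sum => l _; have /andP [] := cherries_incr l indu.
  rewrite big_split -big_distrl -big_distrr /= big_split /= !sum_eq_nat1 -/(deg S u).
  by lra.
move: pu pw puw; rewrite -/du -/dw.
set a1 := \sum_l du l * _; set a2 := \sum_l dw l * _; set a3 := \sum_l du l * dw l.
set b1 := (1 + _) * (_ + _); set b2 := \sum_l _; set b3 := (1 + _) * (_ + _).
set b4 := \sum_l _; set b5 := (1 + _) * _ => ? ? ?.
by lra.
Qed.

Lemma Ex_deg_cherries u v :
  Ex (fun S => (1 + deg S u) * cherries_off S u v) <= 2 * L ^+ 3 * X u * Y v.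
Proof.
apply: le_trans (Ex_deg1_le _ _) _.
- by move=> S; apply: cherries_off_ge0.
- exact: cherries_off_free.
apply: (@le_trans _ _ (2 * L * X u * (L ^+ 2 * Y v))); last by apply: eqle; ring.
by rewrite ler_wpM2l ?Ex_cherries_off // !mulr_ge0.
Qed.

Lemma Ex_sum_ind_cherries u :
  Ex (fun S => \sum_l ind S (l, u) * cherries_off S u l) <= L ^+ 3 * X u.
Proof.
rewrite Ex_sum.
have C0 : 0 <= X u * L ^+ 2 / mu by rewrite divr_ge0 ?mulr_ge0 ?exprn_ge0 // ltW.
apply: le_trans (sum_le_nneg C0 (@sumY 2 isT) _) _; last first.
  by apply: eqle; field; rewrite gt_eqF.
move=> l _; rewrite Ex_ind_free; last exact: cherries_off_free.
apply: (@le_trans _ _ (edge_bound (l, u) * (L ^+ 2 * Y l))).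
  rewrite ler_pM ?prob_le_bound ?Ex_cherries_off ?p0 //.
  by apply: (Ex_ge0 law) => S; apply: cherries_off_ge0.
by apply: eqle; rewrite /edge_bound /=; ring.
Qed.

Lemma Ex_deg_deg u w : w != u ->
  Ex (fun S => (1 + deg S u) * (1 + deg S w)) <= 4 * L ^+ 2 * X u * X w.
Proof.
move=> wu; apply: le_trans (Ex_deg1_le _ _) _.
- by move=> S; rewrite addr_ge0 ?deg_ge0.
- move=> S i; congr (_ + _); apply: eq_bigr => j _.
  by rewrite indU1 xpair_eqE (negbTE wu) andbF.
rewrite (_ : 4 * _ * _ * _ = 2 * L * X u * (2 * L * X w)); last by ring.
rewrite ler_wpM2l ?mulr_ge0 //.
have cst1 : column_free w (fun=> 1) by [].
have := Ex_deg1_le (fun=> ler01) cst1; rewrite (Ex_cst law) mulr1.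
by apply: le_trans; apply: (le_Ex law) => S; rewrite mulr1.
Qed.

(** The constant is [16 + 4 + 16 + 4 + 48 * 4], one summand for each term of the increment bound.
    The increment raises the exponent of every vertex by at most one. *)
Lemma wpaths_variance :
  Ex (fun S => (wpaths S - Ex wpaths) ^+ 2) <= 232 * L ^+ 8 * mu.
Proof.
rewrite (variance_Qsum law wpath_uniq) -/wpaths.
have C0 : 0 <= 232 * L ^+ 3 / mu ^+ 4.
  by rewrite divr_ge0 ?mulr_ge0 ?exprn_ge0 // ltW.
have W := nneg_sum_le_pair (nneg_sum_le_pair (nneg_sum_le_pair (nneg_sum_le_pair
  (@sumX 3 isT) (@sumX 3 isT)) (@sumY 3 isT)) (@sumY 2 isT)) (@sumY 2 isT).
apply: le_trans (sum_le_nneg C0 W _) _; last first.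
  by apply: eqle; field; rewrite gt_eqF.
move=> [[[[u w] v] j] k] ok /=.
have wu : w != u by case/and3P: ok.
(* Each mean in the increment bound involves only some of the five vertex factors. As all of them
   are at least 1, each term is completed to the full product, whose sum factorizes. *)
set B := 232 * L ^+ 3 * (X u * X w * Y v * Y j * Y k).
have B0 : 0 <= B by rewrite !mulr_ge0 ?exprn_ge0.
apply: (@le_trans _ _ (\prod_(e <- wpath (u, w, v, j, k)) edge_bound e * B)); last first.
  by rewrite prod4_bound /B; apply: eqle; field; rewrite gt_eqF.
apply: (@le_trans _ _ (\prod_(e <- wpath (u, w, v, j, k)) p e * B)); last first.
  by rewrite ler_wpM2r ?prod_prob_le.
rewrite ler_wpM2l ?prodr_ge0 //.
apply: le_trans (le_Ex law (fun S => wpaths_incr S ok)) _.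
rewrite !ExD !ExZ.
have split a b c : Ex (fun S => (1 + deg S a) * (cherries_off S a b + cherries_off S a c))
    <= 2 * L ^+ 3 * X a * Y b + 2 * L ^+ 3 * X a * Y c.
  apply: le_trans (lerD (Ex_deg_cherries a b) (Ex_deg_cherries a c)).
  by rewrite -ExD; apply: (le_Ex law) => S; rewrite mulrDr.
have L3 : 0 <= L ^+ 3 by rewrite exprn_ge0.
have pmono (a b c d e : R) : 1 <= a -> 1 <= b -> 1 <= c -> 1 <= d -> 1 <= e ->
    a * c <= a * b * c * d * e.
  move=> a1 b1 c1 d1 e1; have ge0 z : 1 <= z -> 0 <= z :> R by move/(le_trans ler01).
  rewrite (_ : a * b * c * d * e = a * c * (b * d * e)); last by ring.
  by rewrite ler_peMr ?mulr_ge0 ?ge0 // !mulr_ege1.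
have := split u v j; have := split w v k.
have := Ex_sum_ind_cherries u; have := Ex_sum_ind_cherries w.
have := Ex_deg_deg wu.
set P := X u * X w * Y v * Y j * Y k in B B0 *.
have h1 : X u * Y v <= P by apply: pmono.
have h2 : X u * Y j <= P.
  rewrite (_ : P = X u * X w * Y j * Y v * Y k); last by rewrite /P; ring.
  exact: pmono.
have h3 : X w * Y v <= P.
  rewrite (_ : P = X w * X u * Y v * Y j * Y k); last by rewrite /P; ring.
  exact: pmono.
have h4 : X w * Y k <= P.
  rewrite (_ : P = X w * X u * Y k * Y j * Y v); last by rewrite /P; ring.
  exact: pmono.
have h5 : X u * X w <= P.
  rewrite (_ : P = X u * Y v * X w * Y j * Y k); last by rewrite /P; ring.
  exact: pmono.
have h6 : X u <= P by apply: le_trans h5; rewrite ler_peMr.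
have h7 : X w <= P by apply: le_trans h3; rewrite ler_peMr.
have L2 : L ^+ 2 <= L ^+ 3 by rewrite ler_weXn2l.
have P0 : 0 <= P by rewrite !mulr_ge0.
have g (z : R) : z <= P -> L ^+ 3 * z <= L ^+ 3 * P by move=> ?; rewrite ler_wpM2l.
have g1 := g _ h1; have g2 := g _ h2; have g3 := g _ h3; have g4 := g _ h4.
have g6 := g _ h6; have g7 := g _ h7.
have g5 : L ^+ 2 * (X u * X w) <= L ^+ 3 * P by rewrite ler_pM ?mulr_ge0 ?exprn_ge0.
rewrite (_ : 4 * L ^+ 2 * X u * X w = 4 * (L ^+ 2 * (X u * X w))); last by ring.
rewrite (_ : 2 * L ^+ 3 * X u * Y v = 2 * (L ^+ 3 * (X u * Y v))); last by ring.
rewrite (_ : 2 * L ^+ 3 * X u * Y j = 2 * (L ^+ 3 * (X u * Y j))); last by ring.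
rewrite (_ : 2 * L ^+ 3 * X w * Y v = 2 * (L ^+ 3 * (X w * Y v))); last by ring.
rewrite (_ : 2 * L ^+ 3 * X w * Y k = 2 * (L ^+ 3 * (X w * Y k))); last by ring.
rewrite /B (_ : 232 * L ^+ 3 * P = 232 * (L ^+ 3 * P)); last by ring.
move: g1 g2 g3 g4 g5 g6 g7.
set z1 := L ^+ 3 * (X u * Y v); set z2 := L ^+ 3 * _; set z3 := L ^+ 3 * _.
set z4 := L ^+ 3 * _; set z5 := L ^+ 2 * _; set z6 := L ^+ 3 * X u.
set z7 := L ^+ 3 * X w; set z := L ^+ 3 * P.
by move=> *; lra.
Qed.

(** * Means up to bounded errors *)

Definition claw_mean : R := \sum_t \prod_(e <- claw t) edge_weight e.
Definition wpath_mean : R := \sum_t \prod_(e <- wpath t) edge_weight e.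

(** The target sum includes tuples with coincidences, so that it factors into power sums. [C1] pays
    for replacing probabilities by weights and [C2] for the coincidences; both errors have the same
    sign. *)
Lemma mean_gap (I : finType) (P : pred I) (s : I -> seq K) C1 C2 :
  \sum_(t | P t) (\sum_(e <- s t) edge_bound e) * \prod_(e <- s t) edge_bound e <= C1 ->
  \sum_(t | ~~ P t) \prod_(e <- s t) edge_bound e <= C2 ->
  `|\sum_(t | P t) \prod_(e <- s t) p e -
    \sum_t \prod_(e <- s t) edge_weight e| <= C1 + C2.
Proof.
move=> h1 h2; rewrite distrC (bigID P) /= addrAC -sumrB ger0_norm; last first.
  rewrite addr_ge0 ?sumr_ge0 // => t _; last exact: prod_weight_ge0.
  by have /andP [] := prod_weight_sub_prob (s t).
apply: lerD; [apply: le_trans h1|apply: le_trans h2]; apply: ler_sum => t _.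
  by have /andP [] := prod_weight_sub_prob (s t).
exact: prod_weight_le.
Qed.

Lemma sum_bound_onto (I J : finType) (h : J -> I) (P : pred I) (s : I -> seq K)
    (f : J -> R) C M D :
  (forall t, P t -> exists r, h r = t) ->
  0 <= C -> nneg_sum_le f M ->
  (forall r, \prod_(e <- s (h r)) edge_bound e = C * f r) -> C * M = D ->
  \sum_(t | P t) \prod_(e <- s t) edge_bound e <= D.
Proof.
move=> hP C0 fM hf <-; apply: le_trans (sum_le_onto _ hP) _.
  by move=> t; apply: prod_bound_ge0.
by apply: (sum_le_nneg C0 fM) => t _; rewrite hf.
Qed.

Lemma sum_predU_le (I : finType) (P Q : pred I) (F : I -> R) C D :
  (forall t, 0 <= F t) -> \sum_(t | P t) F t <= C -> \sum_(t | Q t) F t <= D ->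
  \sum_(t | P t || Q t) F t <= C + D.
Proof.
move=> F0 hP hQ; apply: le_trans (lerD hP hQ).
have E (P' : pred I) : \sum_(t | P' t) F t = \sum_t if P' t then F t else 0.
  exact: big_mkcond.
rewrite (E P) (E Q) E -big_split /=.
by apply: ler_sum => t _; case: (P t); case: (Q t); rewrite ?addr0 ?add0r ?lerDl.
Qed.

Let mur k : 0 <= mu ^- k. Proof. by rewrite invr_ge0 exprn_ge0 // ltW. Qed.
Let muN : mu != 0. Proof. by rewrite gt_eqF. Qed.
Let Lw k l : (k <= l)%N -> L ^+ k <= L ^+ l. Proof. exact: ler_weXn2l. Qed.

(** The constant 6 counts three edges whose probability is replaced and three possible coincidences
    of leaves. A coincidence loses a vertex but no edge factor, so it costs one power of [mu]. *)
Lemma claws_mean_gap : `|Ex claws - claw_mean| <= 6 * L ^+ 4.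
Proof.
rewrite (Ex_Qsum law claw_uniq).
apply: le_trans (mean_gap (C1 := 3 * L ^+ 4) (C2 := L ^+ 3 + L ^+ 3 + L ^+ 3) _ _) _.
- have C0 : 0 <= 3 / mu ^+ 4 by rewrite mulr_ge0.
  have W := nneg_sum_le_pair (nneg_sum_le_pair (nneg_sum_le_pair
    (@sumX 4 isT) (@sumY 2 isT)) (@sumY 2 isT)) (@sumY 2 isT).
  apply: le_trans (sum_le_nneg C0 W _) _; last by apply: eqle; field.
  move=> [[[u i] j] k] _; rewrite prod3_bound !big_cons big_nil /edge_bound /=.
  (* The sum of three vertex factors is bounded by three times their product, to restore the product
     shape that the majorant needs. *)
  rewrite [leLHS](_ : _ = mu ^- 4 * ((Y i + Y j + Y k) * (Y i * Y j * Y k * X u ^+ 4))); last by field.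
  rewrite [leRHS](_ : _ = mu ^- 4 * (3 * (Y i * Y j * Y k) * (Y i * Y j * Y k * X u ^+ 4))); last by field.
  rewrite ler_wpM2l // ler_wpM2r ?mulr_ge0 ?exprn_ge0 //.
  have h1 : Y i <= Y i * Y j * Y k by rewrite -mulrA ler_peMr // mulr_ege1.
  have h2 : Y j <= Y i * Y j * Y k by rewrite mulrAC ler_peMl // mulr_ege1.
  have h3 : Y k <= Y i * Y j * Y k by rewrite ler_peMl // mulr_ege1.
  by move: h1 h2 h3; set z := _ * _ * _ => *; lra.
- have W := nneg_sum_le_pair (nneg_sum_le_pair (@sumX 3 isT) (@sumY 2 isT)) (@sumY 1 isT).
  rewrite (eq_bigl (fun t : 'I_m * 'I_n * 'I_n * 'I_n => (t.1.1.2 == t.1.2)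
      || (t.1.1.2 == t.2) || (t.1.2 == t.2))); last first.
    by move=> [[[u i] j] k] /=; rewrite !negb_and !negbK orbA.
  apply: sum_predU_le; first by move=> t; apply: prod_bound_ge0.
  apply: sum_predU_le; first by move=> t; apply: prod_bound_ge0.
  + apply: (sum_bound_onto (h := fun r : 'I_m * 'I_n * 'I_n => (r.1.1, r.1.2, r.1.2, r.2))
      _ (mur 3) W); last by field.
      by move=> [[[u i] j] k] /= /eqP ->; exists (u, j, k).
    by move=> r; rewrite prod3_bound; field.
  + apply: (sum_bound_onto (h := fun r : 'I_m * 'I_n * 'I_n => (r.1.1, r.1.2, r.2, r.1.2))
      _ (mur 3) W); last by field.
      by move=> [[[u i] j] k] /= /eqP ->; exists (u, k, j).
    by move=> r; rewrite prod3_bound; field.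
  + apply: (sum_bound_onto (h := fun r : 'I_m * 'I_n * 'I_n => (r.1.1, r.2, r.1.2, r.1.2))
      _ (mur 3) W); last by field.
      by move=> [[[u i] j] k] /= /eqP ->; exists (u, k, i).
    by move=> r; rewrite prod3_bound; field.
have := Lw (isT : 3 <= 4)%N; lra.
Qed.

(** Here the constant is four edges plus three coincidences; merging the two attributes produces the
    exponent 4 of [X]. *)
Lemma wpaths_mean_gap : `|Ex wpaths - wpath_mean| <= 7 * L ^+ 5.
Proof.
rewrite (Ex_Qsum law wpath_uniq).
apply: le_trans (mean_gap (C1 := 4 * L ^+ 5) (C2 := L ^+ 4 + L ^+ 4 + L ^+ 4) _ _) _.
- have C0 : 0 <= 4 / mu ^+ 5 by rewrite mulr_ge0.
  have W := nneg_sum_le_pair (nneg_sum_le_pair (nneg_sum_le_pair (nneg_sum_le_pair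
    (@sumX 3 isT) (@sumX 3 isT)) (@sumY 3 isT)) (@sumY 2 isT)) (@sumY 2 isT).
  apply: le_trans (sum_le_nneg C0 W _) _; last by apply: eqle; field.
  move=> [[[[u w] v] j] k] _; rewrite prod4_bound !big_cons big_nil /edge_bound /=.
  rewrite [leLHS](_ : _ = mu ^- 5 * ((Y v * X u + Y j * X u + Y v * X w + Y k * X w) *
     (Y v ^+ 2 * Y j * Y k * X u ^+ 2 * X w ^+ 2))); last by field.
  set P := X u * X w * Y v * Y j * Y k.
  rewrite [leRHS](_ : _ = mu ^- 5 * (4 * P * (Y v ^+ 2 * Y j * Y k * X u ^+ 2 * X w ^+ 2)));
    last by rewrite /P; field.
  rewrite ler_wpM2l // ler_wpM2r ?mulr_ge0 ?exprn_ge0 //.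
  have pmono (a b c d e : R) : 1 <= a -> 1 <= b -> 1 <= c -> 1 <= d -> 1 <= e ->
      a * b <= a * b * (c * d * e).
    move=> a1 b1 c1 d1 e1; have ge0 z : 1 <= z -> 0 <= z :> R by move/(le_trans ler01).
    by rewrite ler_peMr ?mulr_ge0 ?ge0 // !mulr_ege1.
  have h1 : Y v * X u <= P.
    by rewrite (_ : P = Y v * X u * (Y j * Y k * X w)); [apply: pmono|rewrite /P; ring].
  have h2 : Y j * X u <= P.
    by rewrite (_ : P = Y j * X u * (Y v * Y k * X w)); [apply: pmono|rewrite /P; ring].
  have h3 : Y v * X w <= P.
    by rewrite (_ : P = Y v * X w * (Y j * Y k * X u)); [apply: pmono|rewrite /P; ring].
  have h4 : Y k * X w <= P.
    by rewrite (_ : P = Y k * X w * (Y j * Y v * X u)); [apply: pmono|rewrite /P; ring].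
  by lra.
- rewrite (eq_bigl (fun t : 'I_m * 'I_m * 'I_n * 'I_n * 'I_n => (t.1.1.1.2 == t.1.1.1.1)
      || (t.1.2 == t.1.1.2) || (t.2 == t.1.1.2))); last first.
    by move=> [[[[u w] v] j] k] /=; rewrite !negb_and !negbK orbA.
  apply: sum_predU_le; first by move=> t; apply: prod_bound_ge0.
  apply: sum_predU_le; first by move=> t; apply: prod_bound_ge0.
  + have W := nneg_sum_le_pair (nneg_sum_le_pair (nneg_sum_le_pair
      (@sumX 4 isT) (@sumY 2 isT)) (@sumY 1 isT)) (@sumY 1 isT).
    apply: (sum_bound_onto (h := fun r : 'I_m * 'I_n * 'I_n * 'I_n =>
      (r.1.1.1, r.1.1.1, r.1.1.2, r.1.2, r.2)) _ (mur 4) W); last by field.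
      by move=> [[[[u w] v] j] k] /= /eqP ->; exists (u, v, j, k).
    by move=> r; rewrite prod4_bound; field.
  + have W := nneg_sum_le_pair (nneg_sum_le_pair (nneg_sum_le_pair
      (@sumX 2 isT) (@sumX 2 isT)) (@sumY 3 isT)) (@sumY 1 isT).
    apply: (sum_bound_onto (h := fun r : 'I_m * 'I_m * 'I_n * 'I_n =>
      (r.1.1.1, r.1.1.2, r.1.2, r.1.2, r.2)) _ (mur 4) W); last by field.
      by move=> [[[[u w] v] j] k] /= /eqP ->; exists (u, w, v, k).
    by move=> r; rewrite prod4_bound; field.
  + have W := nneg_sum_le_pair (nneg_sum_le_pair (nneg_sum_le_pair
      (@sumX 2 isT) (@sumX 2 isT)) (@sumY 3 isT)) (@sumY 1 isT).
    apply: (sum_bound_onto (h := fun r : 'I_m * 'I_m * 'I_n * 'I_n =>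
      (r.1.1.1, r.1.1.2, r.1.2, r.2, r.1.2)) _ (mur 4) W); last by field.
      by move=> [[[[u w] v] j] k] /= /eqP ->; exists (u, w, v, j).
    by move=> r; rewrite prod4_bound; field.
have := Lw (isT : 4 <= 5)%N; lra.
Qed.

(** * Cyclic patterns, which carry the counting errors *)

Definition twin_claw (t : 'I_m * 'I_m * 'I_n * 'I_n * 'I_n) : seq K :=
  let: (u, w, i, j, k) := t in
  [:: (i, u); (j, u); (k, u); (i, w); (j, w); (k, w)].
Definition twin_claw_ok (t : 'I_m * 'I_m * 'I_n * 'I_n * 'I_n) : bool :=
  let: (u, w, i, j, k) := t in [&& w != u, i != j, i != k & j != k].
(** A triangle of the affiliation graph whose three edges are witnessed by three different
    attributes. *)
Definition hexagon (t : 'I_m * 'I_m * 'I_m * 'I_n * 'I_n * 'I_n) : seq K :=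
  let: (u, v, w, i, j, k) := t in
  [:: (i, u); (j, u); (j, v); (k, v); (i, w); (k, w)].
Definition hexagon_ok (t : 'I_m * 'I_m * 'I_m * 'I_n * 'I_n * 'I_n) : bool :=
  let: (u, v, w, i, j, k) := t in
  [&& u != v, u != w, v != w, i != j, i != k & j != k].
Definition square (t : 'I_m * 'I_m * 'I_n * 'I_n) : seq K :=
  let: (u, w, v, j) := t in [:: (v, u); (j, u); (v, w); (j, w)].
Definition square_ok (t : 'I_m * 'I_m * 'I_n * 'I_n) : bool :=
  let: (u, w, v, j) := t in (w != u) && (j != v).

Lemma twin_claw_uniq t : twin_claw_ok t -> uniq (twin_claw t).
Proof.
case: t => [[[[u w] i] j] k] /and4P [wu /negbTE ij /negbTE ik /negbTE jk].
move: wu; rewrite eq_sym => /negbTE uw.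
by rewrite /= !inE !xpair_eqE ij ik jk uw !eqxx !andbT !andbF.
Qed.

Lemma hexagon_uniq t : hexagon_ok t -> uniq (hexagon t).
Proof.
case: t => [[[[[u v] w] i] j] k].
move=> /and4P [/negbTE uv /negbTE uw /negbTE vw /and3P [/negbTE ij /negbTE ik /negbTE jk]].
by rewrite /= !inE !xpair_eqE uv uw vw ij ik jk !andbF.
Qed.

Lemma square_uniq t : square_ok t -> uniq (square t).
Proof.
case: t => [[[u w] v] j] /andP [wu jv].
move: wu jv; rewrite eq_sym [j == v]eq_sym => /negbTE uw /negbTE vj.
by rewrite /= !inE !xpair_eqE uw vj !andbF.
Qed.

Lemma Ex_twin_claws : Ex (Qsum twin_claw_ok twin_claw) <= L ^+ 5.
Proof.
rewrite (Ex_Qsum law twin_claw_uniq).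
have W := nneg_sum_le_pair (nneg_sum_le_pair (nneg_sum_le_pair (nneg_sum_le_pair
  (@sumX 3 isT) (@sumX 3 isT)) (@sumY 2 isT)) (@sumY 2 isT)) (@sumY 2 isT).
apply: le_trans (sum_le_nneg (mur 6) W _) _.
  move=> [[[[u w] i] j] k] _; apply: le_trans (prod_prob_le _) _.
  by rewrite !big_cons big_nil /edge_bound /=; apply: eqle; field.
rewrite [leLHS](_ : _ = L ^+ 5 / mu); last by field.
by rewrite ler_pdivrMr // ler_peMr ?exprn_ge0.
Qed.

Lemma Ex_hexagons : Ex (Qsum hexagon_ok hexagon) <= L ^+ 6.
Proof.
rewrite (Ex_Qsum law hexagon_uniq).
have W := nneg_sum_le_pair (nneg_sum_le_pair (nneg_sum_le_pair (nneg_sum_le_pair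
  (nneg_sum_le_pair (@sumX 2 isT) (@sumX 2 isT)) (@sumX 2 isT)) (@sumY 2 isT))
  (@sumY 2 isT)) (@sumY 2 isT).
apply: le_trans (sum_le_nneg (mur 6) W _) _; last by apply: eqle; field.
move=> [[[[[u v] w] i] j] k] _; apply: le_trans (prod_prob_le _) _.
by rewrite !big_cons big_nil /edge_bound /=; apply: eqle; field.
Qed.

Lemma Ex_squares : Ex (Qsum square_ok square) <= L ^+ 4.
Proof.
rewrite (Ex_Qsum law square_uniq).
have W := nneg_sum_le_pair (nneg_sum_le_pair (nneg_sum_le_pair
  (@sumX 2 isT) (@sumX 2 isT)) (@sumY 2 isT)) (@sumY 2 isT).
apply: le_trans (sum_le_nneg (mur 4) W _) _; last by apply: eqle; field.
move=> [[[u w] v] j] _; apply: le_trans (prod_prob_le _) _.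
by rewrite !big_cons big_nil /edge_bound /=; apply: eqle; field.
Qed.

Definition codeg (S : {set K}) (i j : 'I_n) : R :=
  \sum_u ind S (i, u) * ind S (j, u).

Definition linked_square_ok (t : 'I_m * 'I_m * 'I_n * 'I_n * 'I_n) : bool :=
  let: (u, w, v, j, k) := t in [&& w != u, j != v, k != v & k != j].
(** The codegree is not expanded into edges: its attribute may be [u] or [w], which would repeat an
    edge of the square. *)
Definition linked_squares (S : {set K}) : R :=
  \sum_(t | linked_square_ok t)
    (\prod_(e <- square t.1) ind S e) * codeg S t.1.1.2 t.2.

Lemma Ex_linked_squares : Ex linked_squares <= 3 * L ^+ 6.
Proof.
rewrite Ex_sum.
have C0 : 0 <= 3 * L / mu ^+ 5 by rewrite !mulr_ge0.
have W := nneg_sum_le_pair (nneg_sum_le_pair (nneg_sum_le_pair (nneg_sum_le_pair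
  (@sumX 3 isT) (@sumX 3 isT)) (@sumY 3 isT)) (@sumY 2 isT)) (@sumY 1 isT).
apply: le_trans (sum_le_nneg C0 W _) _; last by apply: eqle; field.
move=> [[[[u w] v] j] k] /and4P [wu jv kv kj].
have sq : uniq (square (u, w, v, j)) by apply: square_uniq; rewrite /= wu jv.
rewrite (Ex_prod law _ sq) /=.
set B := 3 * L * Y v * Y k * X u * X w / mu.
have B0 : 0 <= B by rewrite !mulr_ge0 ?invr_ge0 // ltW.
apply: (@le_trans _ _ (\prod_(e <- square (u, w, v, j)) edge_bound e * B)).
  apply: (@le_trans _ _ (\prod_(e <- square (u, w, v, j)) p e * B)); last first.
    by rewrite ler_wpM2r // prod_prob_le.
  rewrite ler_wpM2l ?prodr_ge0 //.
  (* Adding the square gives [v] the attributes [u] and [w], so the codegree grows by at most the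
     indicators of [(k, u)] and [(k, w)]. The three resulting means are the source of the factor
     3. *)
  apply: (@le_trans _ _ (Ex (fun S => codeg S v k + ind S (k, u) + ind S (k, w)))).
    apply: (le_Ex law) => S.
    rewrite -(sum_eq_natM u (fun a => ind S (k, a))) -(sum_eq_natM w (fun a => ind S (k, a))).
    rewrite -!big_split; apply: ler_sum => a _ /=; rewrite -!mulrDl.
    rewrite !ind_setU !inE !xpair_eqE (negbTE kv) (negbTE kj) !eqxx /= ler_wpM2r ?ind_ge0 //.
    rewrite [v == j]eq_sym (negbTE jv) /= orbF; have := ind_ge0 (R := R) S (v, a).
    by case: (a == u); case: (a == w); rewrite /= ?mulr1n ?mulr0n => *; lra.
  have Ex_ind1 e : Ex (fun S => ind S e) = p e.
    have := Ex_prod1 law (isT : uniq [:: e]); rewrite big_seq1 => <-.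
    by apply: eq_Ex => S; rewrite big_seq1.
  rewrite !ExD !Ex_ind1.
  have ED : Ex (fun S => codeg S v k) <= Y v * Y k * L / mu.
    rewrite Ex_sum.
    have C1 : 0 <= Y v * Y k / mu ^+ 2 by rewrite !mulr_ge0.
    apply: le_trans (sum_le_nneg C1 (@sumX 2 isT) _) _; last by apply: eqle; field.
    move=> a _; have /(Ex_prod1 law) : uniq [:: (v, a); (k, a)].
      by rewrite /= inE xpair_eqE eqxx !andbT eq_sym.
    rewrite (eq_Ex (g := fun S => ind S (v, a) * ind S (k, a))); last first.
      by move=> S; rewrite !big_cons big_nil mulr1.
    move=> ->; apply: le_trans (prod_prob_le _) _.
    by rewrite !big_cons big_nil /edge_bound /=; apply: eqle; field.
  have := prob_le_bound (k, u); have := prob_le_bound (k, w); rewrite /edge_bound /=.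
  have nu0 : 0 <= mu^-1 by rewrite invr_ge0 ltW.
  set P := Y v * Y k * X u * X w / mu.
  have f1 : Y v * Y k * L / mu <= L * P.
    rewrite (_ : L * P = (Y v * Y k * L / mu) * (X u * X w)); last by rewrite /P; ring.
    by rewrite ler_peMr ?mulr_ege1 // !mulr_ge0.
  have f2 : Y k * X u / mu <= L * P.
    rewrite (_ : L * P = (Y k * X u / mu) * (L * Y v * X w)); last by rewrite /P; ring.
    by rewrite ler_peMr ?mulr_ege1 // !mulr_ge0.
  have f3 : Y k * X w / mu <= L * P.
    rewrite (_ : L * P = (Y k * X w / mu) * (L * Y v * X u)); last by rewrite /P; ring.
    by rewrite ler_peMr ?mulr_ege1 // !mulr_ge0.
  rewrite (_ : B = 3 * (L * P)); last by rewrite /B /P; ring.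
  move: ED f1 f2 f3; set z1 := _ / mu; set z2 := _ / mu; set z3 := _ / mu.
  by move=> *; lra.
by rewrite !big_cons big_nil /edge_bound /= /B; apply: eqle; field.
Qed.

End BipartiteMoments.

(** * Triangles and 2-paths of the affiliation graph *)

Section GraphCounts.
Context {R : realFieldType}.

Definition distinct3 (V : finType) (t : V * V * V) : bool :=
  let: (i, j, k) := t in [&& i != j, i != k & j != k].

Lemma num_2paths_ordered (V : finType) (G : rel V) : irreflexive G ->
  2 * (num_2paths G)%:R =
  \sum_(t : V * V * V | distinct3 t) (G t.1.1 t.1.2)%:R * (G t.1.1 t.2)%:R :> R.
Proof.
move=> irr; rewrite /num_2paths natr_sum big_distrr [RHS]big_mkcond [RHS]sum_triple /=.
apply: eq_bigr => v _.
have degE : (degree G v)%:R = \sum_j (G v j)%:R :> R.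
  by rewrite /degree -sum1_card natr_sum big_mkcond; apply: eq_bigr => j _; rewrite inE; case: (G v j).
transitivity ((degree G v)%:R ^+ 2 - (degree G v)%:R : R).
  have := bin_ffact (degree G v) 2; rewrite -mulrC => /(congr1 (fun k => k%:R : R)).
  rewrite natrM => ->; case: (degree G v) => [|d]; first by rewrite expr2 mul0r subr0.
  by rewrite ffactnSr ffactn1 subn1 /= natrM -(addn1 d) natrD; ring.
rewrite degE [X in _ - X](_ : _ = \sum_j (G v j)%:R ^+ 2); last first.
  by apply: eq_bigr => j _; case: (G v j); rewrite ?expr1n ?expr0n.
rewrite -sum_off_diag; apply: eq_bigr => j _; rewrite big_mkcond.
apply: eq_bigr => k _; rewrite [k == j]eq_sym.
have [->|vj] := eqVneq v j; first by rewrite irr mul0r if_same.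
have [->|vk] := eqVneq v k; first by rewrite irr mulr0 if_same.
by [].
Qed.

(** Choosing the three entries successively in [A] without repetition gives [3 * 2 * 1]. *)
Lemma sum_distinct3_card3 (V : finType) (A : {set V}) : #|A| = 3%N ->
  \sum_(t : V * V * V | distinct3 t) ([set t.1.1; t.1.2; t.2] == A)%:R = 6 :> R.
Proof.
move=> A3; rewrite big_mkcond sum_triple /=.
transitivity (\sum_(i in A) \sum_(j in A :\ i) \sum_(k in A :\ i :\ j) (1 : R)).
  rewrite [RHS]big_mkcond; apply: eq_bigr => i _.
  rewrite (_ : (if i \in A then _ else _) = \sum_j if (i \in A) && (j \in A :\ i) then
     \sum_(k in A :\ i :\ j) 1 else 0 :> R); last first.
    by case: (i \in A) => /=; [exact: big_mkcond | rewrite big1].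
  apply: eq_bigr => j _.
  rewrite (_ : (if (i \in A) && _ then _ else _) = \sum_k if [&& i \in A, j \in A :\ i & k \in A :\ i :\ j] then
     1 else 0 :> R); last first.
    by case: (i \in A); case: (j \in _) => /=; [exact: big_mkcond | rewrite big1 | rewrite big1 | rewrite big1].
  apply: eq_bigr => k _; rewrite !inE [j == i]eq_sym [k == i]eq_sym [k == j]eq_sym.
  have [->|ij] := eqVneq i j; first by rewrite /= !andbF.
  have [->|ik] := eqVneq i k; first by rewrite /= !andbF.
  have [->|jk] := eqVneq j k; first by rewrite /= !andbF.
  rewrite /=; have -> : [set i; j; k] == A = [&& i \in A, j \in A & k \in A].
    have c3 : #|[set i; j; k]| = 3%N.
      by rewrite setUC cardsU1 cards2 !inE negb_or eq_sym ik [k == j]eq_sym jk ij.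
    by rewrite eqEcard c3 A3 leqnn andbT !subUset !sub1set -andbA.
  exact: mulrb.
rewrite (eq_bigr (fun=> 2)); first by rewrite sumr_const A3; ring.
move=> i iA; have Ai : #|A :\ i| = 2%N by have := cardsD1 i A; rewrite iA A3 => -[].
rewrite (eq_bigr (fun=> 1)); first by rewrite sumr_const Ai.
move=> j jA; have Aj : #|A :\ i :\ j| = 1%N by have := cardsD1 j (A :\ i); rewrite jA Ai => -[].
by rewrite sumr_const Aj.
Qed.

Lemma num_triangles_ordered (V : finType) (G : rel V) : symmetric G ->
  6 * (num_triangles G)%:R =
  \sum_(t : V * V * V | distinct3 t) [&& G t.1.1 t.1.2, G t.1.1 t.2 & G t.1.2 t.2]%:R :> R.
Proof.
move=> sG; rewrite /num_triangles -sum1_card natr_sum mulr_sumr.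
transitivity (\sum_(A : {set V} | (#|A| == 3%N) && [forall i in A, forall j in A, (i != j) ==> G i j])
   \sum_(t : V * V * V | distinct3 t) ([set t.1.1; t.1.2; t.2] == A)%:R : R).
  by apply: eq_bigr => A /andP [/eqP A3 _]; rewrite sum_distinct3_card3 // mulr1.
rewrite exchange_big; apply: eq_bigr => -[[i j] k] /and3P [ij ik jk] /=.
rewrite big_mkcond (bigD1 [set i; j; k]) //= eqxx big1 ?addr0; last first.
  by move=> A /negbTE; rewrite eq_sym => ->; rewrite if_same.
have -> : #|[set i; j; k]| = 3%N.
  by rewrite setUC cardsU1 cards2 !inE negb_or eq_sym ik [k == j]eq_sym jk ij.
rewrite eqxx /=; case: ifP => [/forall_inP H|H].
  have HG a b : a \in [set i; j; k] -> b \in [set i; j; k] -> a != b -> G a b.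
    by move=> /H /forall_inP Ha /Ha /implyP; apply.
  by rewrite !HG // !inE eqxx ?orbT.
case: and3P => // -[Gij Gik Gjk]; move/negP: H; case.
apply/forall_inP => a; rewrite !inE => /orP [/orP [] |] /eqP ->;
  apply/forall_inP => b; rewrite !inE => /orP [/orP [] |] /eqP ->;
  by rewrite ?eqxx //= ?Gij ?Gik ?Gjk ?implybT // sG ?Gij ?Gik ?Gjk implybT.
Qed.

End GraphCounts.

Section AffiliationCounts.
Context {R : realFieldType} {n m : nat}.
Local Notation K := ('I_n * 'I_m)%type.
Variable S : {set K}.
Local Notation ind := (@ind R _).
Local Notation claws := (@claws R n m).
Local Notation wpaths := (@wpaths R n m).
Local Notation codeg := (@codeg R n m S).
Local Notation G := (affiliation_graph S).

Lemma affiliation_irr : irreflexive G.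
Proof. by move=> i; rewrite /affiliation_graph eqxx. Qed.

Lemma affiliation_sym : symmetric G.
Proof.
move=> i j; rewrite /affiliation_graph eq_sym; congr (_ && _).
by apply: eq_existsb => u; rewrite andbC.
Qed.

Lemma ind_sqr e : ind S e ^+ 2 = ind S e.
Proof. by rewrite !indE; case: (e \in S); rewrite ?expr1n ?expr0n. Qed.

Lemma affiliation_codeg i j : i != j ->
  (G i j /\ 1 <= codeg i j) \/ (G i j = false /\ codeg i j = 0).
Proof.
move=> ij; rewrite /affiliation_graph ij /=.
case: existsP => [[u /andP [iu ju]]|nex]; [left|right]; split=> //.
  rewrite -[leRHS]/(\sum_u ind S (i, u) * ind S (j, u)) (bigD1 u) //= !indE iu ju.
  by rewrite mulr1 lerDl sumr_ge0 // => w _; rewrite mulr_ge0 ?ind_ge0.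
apply: big1 => u _; rewrite !indE -natrM mulnb; case: andP => // iuju.
by case: nex; exists u; apply/andP.
Qed.

Lemma codeg_falling i j : 
  codeg i j ^+ 2 - codeg i j =
  \sum_u \sum_(w | w != u) (ind S (i, u) * ind S (j, u)) * (ind S (i, w) * ind S (j, w)).
Proof.
rewrite sum_off_diag; congr (_ - _).
by apply: eq_bigr => u _; rewrite exprMn !ind_sqr.
Qed.

Lemma linked_squaresE :
  linked_squares S = \sum_(t : 'I_n * 'I_n * 'I_n | distinct3 t)
    (codeg t.1.1 t.1.2 ^+ 2 - codeg t.1.1 t.1.2) * codeg t.1.1 t.2.
Proof.
rewrite /linked_squares big_mkcond sum_quint [RHS]big_mkcond sum_triple.
transitivity (\sum_v \sum_j \sum_k \sum_u \sum_w
   if linked_square_ok (u, w, v, j, k) then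
     (\prod_(e <- square (u, w, v, j)) ind S e) * codeg v k else 0).
  rewrite (eq_bigr (fun u => \sum_v \sum_w \sum_j \sum_k
     if linked_square_ok (u, w, v, j, k) then
     (\prod_(e <- square (u, w, v, j)) ind S e) * codeg v k else 0)); last first.
    by move=> u _; rewrite exchange_big.
  rewrite exchange_big; apply: eq_bigr => v _ /=.
  rewrite (eq_bigr (fun u => \sum_j \sum_w \sum_k
     if linked_square_ok (u, w, v, j, k) then
     (\prod_(e <- square (u, w, v, j)) ind S e) * codeg v k else 0)); last first.
    by move=> u _; rewrite exchange_big.
  rewrite exchange_big; apply: eq_bigr => j _ /=.
  rewrite (eq_bigr (fun u => \sum_k \sum_w
     if linked_square_ok (u, w, v, j, k) then
     (\prod_(e <- square (u, w, v, j)) ind S e) * codeg v k else 0)); last first.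
    by move=> u _; rewrite exchange_big.
  by rewrite exchange_big.
apply: eq_bigr => v _; apply: eq_bigr => j _; apply: eq_bigr => k _ /=.
rewrite [v == j]eq_sym [v == k]eq_sym [j == k]eq_sym.
case: and3P => [_|_]; last first.
  by rewrite big1 // => u _; rewrite big1 // => w _; rewrite andbF.
rewrite codeg_falling big_distrl; apply: eq_bigr => u _ /=.
rewrite big_distrl /= [RHS]big_mkcond; apply: eq_bigr => w _.
rewrite andbT; case: ifP => // _.
by rewrite !big_cons big_nil; ring.
Qed.

Lemma clawsE :
  claws S = \sum_(t : 'I_n * 'I_n * 'I_n | distinct3 t)
    \sum_u ind S (t.1.1, u) * ind S (t.1.2, u) * ind S (t.2, u).
Proof.
rewrite -[LHS]/(Qsum claw_ok claw S) /Qsum big_mkcond sum_quad [RHS]big_mkcond sum_triple.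
rewrite exchange_big; apply: eq_bigr => i _ /=.
rewrite exchange_big; apply: eq_bigr => j _ /=.
rewrite exchange_big; apply: eq_bigr => k _ /=.
case: ifP => _; last by rewrite big1.
by apply: eq_bigr => u _; rewrite !big_cons big_nil; ring.
Qed.

(** The attributes behind the two codegrees either agree, which gives claws, or differ, which gives
    paths. Since [wpath_ok] allows the ends [j] and [k] to agree, those closed paths, which are
    squares, are subtracted. *)
Lemma codeg_products_sum :
  \sum_(t : 'I_n * 'I_n * 'I_n | distinct3 t) codeg t.1.1 t.1.2 * codeg t.1.1 t.2 =
  claws S + wpaths S - Qsum square_ok square S.
Proof.
have -> : Qsum square_ok square S = \sum_v \sum_(j | j != v)
    (codeg v j ^+ 2 - codeg v j).
  rewrite /Qsum big_mkcond sum_quad.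
  rewrite (eq_bigr (fun u => \sum_v \sum_w \sum_j
     if square_ok (u, w, v, j) then \prod_(e <- square (u, w, v, j)) ind S e else 0));
    last by move=> u _; rewrite exchange_big.
  rewrite exchange_big; apply: eq_bigr => v _ /=; rewrite [RHS]big_mkcond.
  rewrite (eq_bigr (fun u => \sum_j \sum_w
     if square_ok (u, w, v, j) then \prod_(e <- square (u, w, v, j)) ind S e else 0));
    last by move=> u _; rewrite exchange_big.
  rewrite exchange_big; apply: eq_bigr => j _ /=.
  case: ifP => jv; last by rewrite big1 // => u _; rewrite big1 // => w _; rewrite andbF.
  rewrite codeg_falling; apply: eq_bigr => u _; rewrite [RHS]big_mkcond.
  apply: eq_bigr => w _; rewrite andbT; case: ifP => // _.
  by rewrite !big_cons big_nil; ring.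
rewrite clawsE wpathsE big_mkcond sum_triple [\sum_(t | distinct3 t) _]big_mkcond sum_triple.
rewrite -big_split -sumrB; apply: eq_bigr => v _ /=.
have sumD : \sum_(j | j != v) codeg v j = \sum_u cherries S u v :> R.
  by rewrite exchange_big.
have -> : \sum_u \sum_(w | w != u) cherries S u v * cherries S w v =
    \sum_(j | j != v) \sum_(k | k != v) (codeg v j * codeg v k) -
    \sum_(j | j != v) \sum_(k | k != v)
      \sum_u ind S (v, u) * ind S (j, u) * ind S (k, u) :> R.
  rewrite sum_off_diag -sumD; congr (_ - _).
    by rewrite expr2 big_distrl; apply: eq_bigr => j _; rewrite big_distrr.
  rewrite [RHS](eq_bigr (fun j => \sum_u \sum_(k | k != v)
      ind S (v, u) * ind S (j, u) * ind S (k, u))); last by move=> j _; rewrite exchange_big.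
  rewrite exchange_big; apply: eq_bigr => u _ /=.
  rewrite expr2 big_distrl; apply: eq_bigr => j _; rewrite big_distrr.
  apply: eq_bigr => k _ /=; rewrite -[in RHS](ind_sqr (v, u)); ring.
(* Isolates the diagonal [j = k], where the product of codegrees becomes a square and the claw sum
   collapses to a codegree. *)
have split (F : 'I_n -> 'I_n -> R) : \sum_(j | j != v) \sum_(k | k != v) F j k =
   \sum_j \sum_k (if [&& v != j, v != k & j != k] then F j k else 0) +
   \sum_(j | j != v) F j j.
  rewrite [in LHS]big_mkcond [\sum_(j | j != v) F j j]big_mkcond -big_split /=.
  apply: eq_bigr => j _; rewrite [j == v]eq_sym.
  have [vj|vj] := boolP (v == j); first by rewrite /= big1 ?addr0.
  rewrite /=.
  rewrite (bigD1 j) /=; last by rewrite eq_sym.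
  rewrite addrC; congr (_ + _); rewrite big_mkcond; apply: eq_bigr => k _.
  by rewrite [k == v]eq_sym [k == j]eq_sym.
rewrite !split; set a := \sum_j \sum_k _; set b := \sum_j \sum_k _.
have -> : \sum_(j | j != v) \sum_u ind S (v, u) * ind S (j, u) * ind S (j, u) =
   \sum_(j | j != v) codeg v j.
  apply: eq_bigr => j _; apply: eq_bigr => u _.
  by rewrite -mulrA -expr2 ind_sqr.
rewrite sumrB (eq_bigr (F1 := fun j => codeg v j * codeg v j) (fun j => codeg v j ^+ 2)) //.
ring.
Qed.

(** For codegrees [a, b >= 1], the error [a * b - 1] is at most
    [(a ^+ 2 - a) * b + (b ^+ 2 - b) * a]; if one of them vanishes there is no error. The two halves
    are exchanged by swapping the ends, hence the factor 2. *)
Lemma num_2paths_codeg :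
  `|2 * (num_2paths G)%:R - (claws S + wpaths S)| <=
  2 * linked_squares S + Qsum square_ok square S :> R.
Proof.
rewrite (num_2paths_ordered affiliation_irr).
set N := \sum_(t | _) _; have := codeg_products_sum.
set D := \sum_(t | _) _ => DE.
have ND : `|N - D| <= 2 * linked_squares S.
  rewrite /N /D -sumrB; apply: le_trans (ler_norm_sum _ _ _) _.
  have sym : linked_squares S = \sum_(t : 'I_n * 'I_n * 'I_n | distinct3 t)
      (codeg t.1.1 t.2 ^+ 2 - codeg t.1.1 t.2) * codeg t.1.1 t.1.2.
    rewrite linked_squaresE !(big_mkcond (@distinct3 _)) !sum_triple.
    apply: eq_bigr => v _; rewrite exchange_big; apply: eq_bigr => k _.
    apply: eq_bigr => j _ /=; rewrite [j == k]eq_sym.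
    by rewrite andbA [(v != j) && _]andbC -andbA.
  rewrite mulr_natl mulr2n {1}linked_squaresE sym -big_split; apply: ler_sum => -[[v j] k].
  move=> /and3P [vj vk jk] /=.
  case: (affiliation_codeg vj) => -[-> Dj]; case: (affiliation_codeg vk) => -[-> Dk] /=;
    rewrite ?Dj ?Dk ?expr0n /= ?(mul0r, mulr0, mul1r, mulr1, subr0, subrr, oppr0, normr0, addr0, add0r) //.
  rewrite distrC ger0_norm; last by rewrite subr_ge0 mulr_ege1.
  move: Dj Dk; set a := codeg v j; set b := codeg v k => a1 b1.
  rewrite -subr_ge0 (_ : _ - _ = (a - 1) * b * (a - 1) + (b - 1) * (b * a - 1)); last by ring.
  rewrite addr_ge0 ?mulr_ge0 ?subr_ge0 ?mulr_ege1 //; exact: le_trans b1.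
rewrite (_ : N - _ = N - D - Qsum square_ok square S); last by rewrite DE; ring.
apply: le_trans (ler_normB _ _) _; apply: lerD => //.
by rewrite ger0_norm // sumr_ge0 // => t _; apply: prod_ind_ge0.
Qed.

(** For a triple with [z >= 1] common attributes the error is [z - 1 <= z ^+ 2 - z], which counts
    twin claws. If [z = 0], a triangle needs a witness for each edge, and two equal witnesses would
    be common to all three vertices, so it yields a hexagon. *)
Lemma num_triangles_claws :
  `|6 * (num_triangles G)%:R - claws S| <=
  Qsum twin_claw_ok twin_claw S + Qsum hexagon_ok hexagon S :> R.
Proof.
rewrite (num_triangles_ordered affiliation_sym) clawsE -sumrB.
pose tau (t : 'I_n * 'I_n * 'I_n) u := ind S (t.1.1, u) * ind S (t.1.2, u) * ind S (t.2, u).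
pose hex (t : 'I_n * 'I_n * 'I_n) (r : 'I_m * 'I_m * 'I_m) : R :=
  if [&& r.1.1 != r.1.2, r.1.1 != r.2 & r.1.2 != r.2] then
   \prod_(e <- hexagon (r.1.1, r.1.2, r.2, t.1.1, t.1.2, t.2)) ind S e else 0.
have twinE : Qsum twin_claw_ok twin_claw S = \sum_(t | distinct3 t)
    \sum_u \sum_(w | w != u) tau t u * tau t w.
  rewrite exchange_big /Qsum /= big_mkcond sum_quint; apply: eq_bigr => u _ /=.
  rewrite [RHS]big_mkcond sum_triple /= exchange_big; apply: eq_bigr => i _ /=.
  rewrite exchange_big; apply: eq_bigr => j _ /=.
  rewrite exchange_big; apply: eq_bigr => k _ /=.
  case: (boolP [&& i != j, i != k & j != k]) => [ijk|_]; last first.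
    by rewrite big1 // => w _; rewrite andbF.
  rewrite [RHS]big_mkcond; apply: eq_bigr => w _; rewrite andbT; case: ifP => // _.
  by rewrite !big_cons big_nil /tau /=; ring.
have hexE : Qsum hexagon_ok hexagon S = \sum_(t | distinct3 t) \sum_r hex t r.
  rewrite exchange_big /Qsum /=.
  rewrite (reindex (fun z : ('I_m * 'I_m * 'I_m) * ('I_n * 'I_n * 'I_n) =>
    (z.1.1.1, z.1.1.2, z.1.2, z.2.1.1, z.2.1.2, z.2.2))) /=; last first.
    exists (fun t : 'I_m * 'I_m * 'I_m * 'I_n * 'I_n * 'I_n =>
      (t.1.1.1.1.1, t.1.1.1.1.2, t.1.1.1.2, (t.1.1.2, t.1.2, t.2))).
      by move=> [[[u v] w] [[i j] k]].
    by move=> [[[[[u v] w] i] j] k].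
  rewrite big_mkcond -(pair_bigA _ (fun (r : 'I_m * 'I_m * 'I_m) (t : 'I_n * 'I_n * 'I_n) =>
    if [&& r.1.1 != r.1.2, r.1.1 != r.2, r.1.2 != r.2, t.1.1 != t.1.2, t.1.1 != t.2 & t.1.2 != t.2]
    then \prod_(e <- hexagon (r.1.1, r.1.2, r.2, t.1.1, t.1.2, t.2)) ind S e else 0)) /=.
  apply: eq_bigr => r _; rewrite [RHS]big_mkcond; apply: eq_bigr => -[[i j] k] _ /=.
  rewrite /hex; case: (r.1.1 != r.1.2); case: (r.1.1 != r.2); case: (r.1.2 != r.2);
    by rewrite //= if_same.
rewrite twinE hexE -big_split; apply: le_trans (ler_norm_sum _ _ _) _.
apply: ler_sum => -[[i j] k] /and3P [ij ik jk] /=.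
have tau0 t u : 0 <= tau t u by rewrite !mulr_ge0 ?ind_ge0.
have hex0 t r : 0 <= hex t r by rewrite /hex; case: ifP => // _; apply: prod_ind_ge0.
set t := (i, j, k); have -> : \sum_u ind S (i, u) * ind S (j, u) * ind S (k, u) =
  \sum_u tau t u by [].
have sum_hex0 : 0 <= \sum_r hex t r by apply: sumr_ge0.
have [/existsP [u /and3P [iu ju ku]]|nex] :=
  boolP [exists u, [&& (i, u) \in S, (j, u) \in S & (k, u) \in S]].
  have edge a b : a != b -> (a, u) \in S -> (b, u) \in S -> G a b.
    by move=> ab au bu; rewrite /affiliation_graph ab; apply/existsP; exists u; rewrite au bu.
  rewrite !edge //= mulr1n sum_off_diag.
  have -> : \sum_u tau t u ^+ 2 = \sum_u tau t u.
    by apply: eq_bigr => w _; rewrite /tau !exprMn !ind_sqr.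
  have : 1 <= \sum_u tau t u.
    rewrite (bigD1 u) //= {1}/tau !indE iu ju ku !mulr1 lerDl.
    by apply: sumr_ge0.
  set z := \sum_u _ => z1; rewrite distrC ger0_norm ?subr_ge0 //.
  apply: ler_wpDr => //.
  rewrite -subr_ge0 (_ : _ - _ = (z - 1) * (z - 1)); last by ring.
  by rewrite -expr2 sqr_ge0.
rewrite big1; last first.
  move=> u _; rewrite /tau !indE -!natrM !mulnb.
  case: andP => // -[/andP [iu ju] ku]; case/existsP: nex; exists u.
  exact/and3P.
rewrite subr0 ger0_norm ?ler0n // ler_wpDl //.
  by apply: sumr_ge0 => u _; apply: sumr_ge0 => w _; rewrite mulr_ge0.
case: and3P => // -[Gij Gik Gjk].
have wit a b : G a b -> exists u, ((a, u) \in S) && ((b, u) \in S).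
  by case/andP => _ /existsP.
have [u /andP [iu ju]] := wit _ _ Gij; have [v /andP [jv kv]] := wit _ _ Gjk.
have [w /andP [iw kw]] := wit _ _ Gik.
rewrite (bigD1 (u, v, w)) //= {1}/hex /=.
have no a : ~ [/\ (i, a) \in S, (j, a) \in S & (k, a) \in S].
  by move=> /and3P H; case/existsP: nex; exists a.
have uv : u != v by apply/eqP => E; apply: (no u); split=> //; rewrite E.
have uw : u != w by apply/eqP => E; apply: (no u); split=> //; rewrite E.
have vw : v != w by apply/eqP => E; apply: (no v); split=> //; rewrite E.
rewrite uv uw vw !big_cons big_nil !indE iu ju jv kv iw kw !mulr1 lerDl.
by apply: sumr_ge0.
Qed.

End AffiliationCounts.

(** * Mean absolute deviations at fixed size *)

Section Deviation.
Context {R : realFieldType} {n m : nat}.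
Local Notation K := ('I_n * 'I_m)%type.

Lemma sum_pairM (A B : finType) (f : A -> R) (g : B -> R) :
  \sum_(t : A * B) f t.1 * g t.2 = (\sum_a f a) * (\sum_b g b).
Proof.
rewrite big_distrl -(pair_bigA _ (fun a b => f a * g b)); apply: eq_bigr => a _.
by rewrite /= big_distrr.
Qed.

Lemma claw_meanE (y : 'I_n -> R) (x : 'I_m -> R) (mu : R) : mu != 0 ->
  claw_mean y x mu = (\sum_u x u ^+ 3) * (\sum_i y i) ^+ 3 / mu ^+ 3.
Proof.
move=> mu0; rewrite (_ : _ / _ = mu ^- 3 * ((\sum_u x u ^+ 3) * (\sum_i y i) *
  (\sum_i y i) * (\sum_i y i))); last by ring.
rewrite -(sum_pairM (fun u => x u ^+ 3) y).
rewrite -(sum_pairM (fun t => x t.1 ^+ 3 * y t.2) y).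
rewrite -(sum_pairM (fun t => x t.1.1 ^+ 3 * y t.1.2 * y t.2) y).
rewrite big_distrr; apply: eq_bigr => -[[[u i] j] k] _.
by rewrite !big_cons big_nil /edge_weight /=; field.
Qed.

Lemma wpath_meanE (y : 'I_n -> R) (x : 'I_m -> R) (mu : R) : mu != 0 ->
  wpath_mean y x mu =
  (\sum_u x u ^+ 2) ^+ 2 * (\sum_i y i ^+ 2) * (\sum_i y i) ^+ 2 / mu ^+ 4.
Proof.
move=> mu0; rewrite [RHS](_ : _ = mu ^- 4 * ((\sum_u x u ^+ 2) * (\sum_u x u ^+ 2) *
  (\sum_i y i ^+ 2) * (\sum_i y i) * (\sum_i y i))); last by field.
rewrite -(sum_pairM (fun u => x u ^+ 2) (fun u => x u ^+ 2)).
rewrite -(sum_pairM (fun t => x t.1 ^+ 2 * x t.2 ^+ 2) (fun i => y i ^+ 2)).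
rewrite -(sum_pairM (fun t => x t.1.1 ^+ 2 * x t.1.2 ^+ 2 * y t.2 ^+ 2) y).
rewrite -(sum_pairM (fun t => x t.1.1.1 ^+ 2 * x t.1.1.2 ^+ 2 * y t.1.2 ^+ 2 * y t.2) y).
rewrite big_distrr; apply: eq_bigr => -[[[[u w] v] j] k] _.
by rewrite !big_cons big_nil /edge_weight /=; field.
Qed.

Variables (q : {set K} -> R) (p : K -> R).
Variables (y : 'I_n -> R) (x : 'I_m -> R) (mu L s : R).
Hypothesis law : inclusion_law q p.
Hypothesis wts : sparse_weights y x mu L.
Hypothesis prb : sparse_probs p y x mu.
Hypothesis s0 : 0 < s.
Hypothesis s2 : s ^+ 2 = mu.

Local Notation Ex := (Ex q).
Local Notation MT := (claw_mean y x mu).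
Local Notation MQ := (wpath_mean y x mu).

Let L1 : 1 <= L. Proof. by case: wts. Qed.
Let s1 : 1 <= s.
Proof.
have [mu1 _ _ _ _] := wts; move: mu1; rewrite -s2 expr_ge1 //; exact: ltW.
Qed.

(** The inequality [z <= s / 2 + z ^+ 2 / (2 * s)] replaces Cauchy-Schwarz, so no root of an
    expectation is taken and the bound stays linear in [V]. *)
Lemma Ex_dist_mean_le f V : Ex (fun S => (f S - Ex f) ^+ 2) <= V * mu ->
  Ex (fun S => `|f S - Ex f|) <= (1 + V) / 2 * s.
Proof.
move=> hV; set M := Ex f in hV *.
apply: (@le_trans _ _ (Ex (fun S => s / 2 + (2 * s)^-1 * (f S - M) ^+ 2))).
  apply: (le_Ex law) => S; rewrite -[(f S - M) ^+ 2]real_normK ?num_real //.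
  set z := `|_|; rewrite -subr_ge0 (_ : _ - _ = (2 * s)^-1 * (s - z) ^+ 2).
    by rewrite mulr_ge0 ?sqr_ge0 // invr_ge0 mulr_ge0 // ltW.
  by field; rewrite gt_eqF.
rewrite ExD (Ex_cst law) ExZ.
apply: (@le_trans _ _ (s / 2 + (2 * s)^-1 * (V * mu))).
  by rewrite lerD2l ler_wpM2l // invr_ge0 mulr_ge0 // ltW.
by rewrite -s2 le_eqVlt; apply/orP; left; apply/eqP; field; rewrite gt_eqF.
Qed.

(** The bounded errors contribute [1 + 1 + 6] and the variance term at most 217. All are absorbed
    into [L ^+ 6 * s] since [L] and [s] are at least 1. *)
Lemma triangles_deviation :
  Ex (fun S => `|6 * (num_triangles (affiliation_graph S))%:R - MT|) <=
  225 * L ^+ 6 * s.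
Proof.
set T := @claws R n m.
apply: (@le_trans _ _ (Ex (fun S => Qsum twin_claw_ok twin_claw S +
   Qsum hexagon_ok hexagon S + `|T S - Ex T| + `|Ex T - MT|))).
  apply: (le_Ex law) => S; set N := 6 * _.
  rewrite (_ : N - MT = (N - T S) + (T S - Ex T) + (Ex T - MT)); last by ring.
  apply: le_trans (ler_normD _ _) _; rewrite lerD2r.
  apply: le_trans (ler_normD _ _) _; rewrite lerD2r.
  exact: num_triangles_claws.
rewrite !ExD (Ex_cst law).
have := Ex_twin_claws law wts prb; have := Ex_hexagons law wts prb.
have := claws_mean_gap law wts prb.
have := Ex_dist_mean_le (claws_variance law wts prb); rewrite -/T.
set e1 := Ex (fun=> _); set e2 := `|_|; set e3 := Ex _; set e4 := Ex _ => h1 h2 h3 h4.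
have l4 : L ^+ 4 <= L ^+ 6 by rewrite ler_weXn2l.
have l5 : L ^+ 5 <= L ^+ 6 by rewrite ler_weXn2l.
have l0 : 1 <= L ^+ 6 by rewrite exprn_ege1.
have l6 : L ^+ 6 <= L ^+ 6 * s by rewrite ler_peMr // (le_trans ler01).
have : (1 + 216 * L ^+ 6) / 2 * s <= 217 * (L ^+ 6 * s).
  by rewrite (mulrA 217); apply: ler_wpM2r; [exact: ltW|lra].
by rewrite -(mulrA 225); set z := L ^+ 6 * s in l6 * => *; lra.
Qed.

Lemma paths_deviation :
  Ex (fun S => `|2 * (num_2paths (affiliation_graph S))%:R - (MT + MQ)|) <=
  500 * L ^+ 8 * s.
Proof.
set T := @claws R n m; set Q := @wpaths R n m.
apply: (@le_trans _ _ (Ex (fun S => 2 * linked_squares S +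
   Qsum square_ok square S + `|T S - Ex T| + `|Q S - Ex Q| + (`|Ex T - MT| +
   `|Ex Q - MQ|)))).
  apply: (le_Ex law) => S; set N := 2 * _.
  rewrite (_ : N - (MT + MQ) = (N - (T S + Q S)) + (T S - Ex T) + (Q S - Ex Q) +
    ((Ex T - MT) + (Ex Q - MQ))); last by ring.
  apply: le_trans (ler_normD _ _) _; apply: lerD; last exact: ler_normD.
  apply: le_trans (ler_normD _ _) _; rewrite lerD2r.
  apply: le_trans (ler_normD _ _) _; rewrite lerD2r.
  exact: num_2paths_codeg.
rewrite !ExD ExZ !(Ex_cst law).
have := Ex_linked_squares law wts prb; have := Ex_squares law wts prb.
have := claws_mean_gap law wts prb; have := wpaths_mean_gap law wts prb.
have := Ex_dist_mean_le (claws_variance law wts prb).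
have := Ex_dist_mean_le (wpaths_variance law wts prb); rewrite -/T -/Q.
set e1 := Ex (fun=> _); set e2 := Ex (fun=> _); set e3 := `|_|; set e4 := `|_|.
set e5 := Ex _; set e6 := Ex _ => h1 h2 h3 h4 h5 h6.
have l4 : L ^+ 4 <= L ^+ 8 by rewrite ler_weXn2l.
have l5 : L ^+ 5 <= L ^+ 8 by rewrite ler_weXn2l.
have l6 : L ^+ 6 <= L ^+ 8 by rewrite ler_weXn2l.
have l0 : 1 <= L ^+ 8 by rewrite exprn_ege1.
have l8 : L ^+ 8 <= L ^+ 8 * s by rewrite ler_peMr // (le_trans ler01).
have g1 : (1 + 216 * L ^+ 6) / 2 * s <= 217 / 2 * (L ^+ 8 * s).
  by rewrite (mulrA (217 / 2)); apply: ler_wpM2r; [exact: ltW|lra].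
have g2 : (1 + 232 * L ^+ 8) / 2 * s <= 233 / 2 * (L ^+ 8 * s).
  by rewrite (mulrA (233 / 2)); apply: ler_wpM2r; [exact: ltW|lra].
by rewrite -(mulrA 500); set z := L ^+ 8 * s in l8 g1 g2 * => *; lra.
Qed.

End Deviation.

(** * The law of the random graph and the limit *)

Local Open Scope classical_set_scope.

Section GraphLaw.
Context {R : realType} {d : measure_display} {T : measurableType d}.
Context {P : probability T R} {n m : nat}.
Local Notation K := ('I_n * 'I_m)%type.
Variables (y : 'I_n -> R) (x : 'I_m -> R) (mu : R) (H : T -> {set K}).

Definition graph_law (P : probability T R) (H : T -> {set K}) (S : {set K}) : R :=
  fine (P [set w | H w = S]).

Hypothesis rbg : random_bipartite_graph P y x mu H.

Lemma measurable_graph S : measurable [set w | H w = S].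
Proof.
have [mE _ _] := rbg.
have -> : [set w | H w = S] =
    \bigcap_(e in [set: K]) (if e \in S then edge_event H e else ~` edge_event H e).
  apply/seteqP; split=> w /=.
    by move=> <- e _; case: ifPn => [//|/negP].
  move=> Hw; apply/setP => e; have := Hw e I.
  by case: ifPn => [_ ->//|_ /= /negP /negbTE ->].
apply: fin_bigcap_measurable => // e _; case: ifP => _ //.
exact: measurableC.
Qed.

Lemma prob_graph_seq (s : seq {set K}) : uniq s ->
  measurable [set w | H w \in s] /\
  P [set w | H w \in s] = (\sum_(S <- s) graph_law P H S)%:E.
Proof.
elim: s => [_|S s IH /= /andP [Ss us]].
  rewrite (_ : [set w | _] = classical_sets.set0); last by apply/seteqP; split.
  by rewrite big_nil measure0.
have [ms Ps] := IH us.
have -> : [set w | H w \in S :: s] = [set w | H w = S] `|` [set w | H w \in s].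
  apply/seteqP; split=> w /=; rewrite inE.
    by case/orP => [/eqP ->|]; [left|right].
  by case=> [->|->]; rewrite ?eqxx ?orbT.
split; first by apply: measurableU => //; exact: measurable_graph.
rewrite measureU //; first last.
- apply/seteqP; split=> w //= -[HS]; rewrite HS => Hs; by rewrite Hs in Ss.
- exact: measurable_graph.
rewrite big_cons EFinD -Ps fineK // fin_num_measure //; exact: measurable_graph.
Qed.

Lemma measurable_graph_pred (B : pred {set K}) : measurable [set w | B (H w)].
Proof.
have [mB _] := prob_graph_seq (filter_uniq B (index_enum_uniq {set K})).
rewrite (_ : [set w | _] = [set w | H w \in [seq S <- index_enum {set K} | B S]]) //.
by apply/seteqP; split=> w /=; rewrite mem_filter mem_index_enum andbT.
Qed.

Lemma prob_graph (B : pred {set K}) :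
  P [set w | B (H w)] = (\sum_(S | B S) graph_law P H S)%:E.
Proof.
rewrite -big_filter.
have [_ <-] := prob_graph_seq (filter_uniq B (index_enum_uniq {set K})).
by congr (P _); apply/seteqP; split=> w /=; rewrite mem_filter mem_index_enum andbT.
Qed.

Lemma graph_law_inclusion : inclusion_law (graph_law P H) (edge_prob y x mu).
Proof.
have [_ PE ind] := rbg; split=> [S|A]; first by rewrite fine_ge0.
apply: EFin_inj; rewrite -prob_graph.
have -> : [set w | (A \subset H w)%B] = \bigcap_(e in [set e | e \in A]) edge_event H e.
  apply/seteqP; split=> w /=; first by move=> /fintype.subsetP AH e /AH.
  by move=> AH; apply/fintype.subsetP => e /AH.
rewrite ind (eq_bigr (fun e => (edge_prob y x mu e)%:E)); last by move=> e _; exact: PE.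
by rewrite (big_morph EFin (@EFinM R) (erefl 1%:E)).
Qed.

Lemma markov_graph (z : {set K} -> R) (k : R) : 0 < k ->
  (P [set w | k < `|z (H w)|]%R <= (Ex (graph_law P H) (fun S => `|z S|) / k)%:E)%E.
Proof.
move=> k0; rewrite (prob_graph (fun S => k < `|z S|)) lee_fin ler_pdivlMr //.
rewrite big_distrl big_mkcond /=; apply: ler_sum => S _.
have q0 := graph_law_inclusion.1 S.
by case: ifP => [/ltW zk|_]; [rewrite ler_wpM2l | rewrite mulr_ge0].
Qed.

Lemma edge_prob_sparse : 0 < mu -> (forall i, 0 <= y i) -> (forall u, 0 <= x u) ->
  sparse_probs (edge_prob y x mu) y x mu.
Proof.
move=> mu0 y0 x0 [i u]; rewrite /edge_prob /edge_weight /=.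
have: 0 <= y i * x u by rewrite mulr_ge0.
set a := y i * x u => a0; have amu : 0 < a + mu by rewrite ltr_wpDl.
split; first by rewrite ler_wpM2l // lef_pV2 ?posrE // lerDr.
rewrite (_ : _ - _ = a ^+ 2 / (mu * (a + mu))); last by field; rewrite !gt_eqF.
rewrite expr_div_n ler_wpM2l ?sqr_ge0 // lef_pV2 ?posrE ?mulr_gt0 ?exprn_gt0 //.
by rewrite expr2 ler_wpM2l ?lerDr // ltW.
Qed.

End GraphLaw.

(** * Tightness from bounds in mean *)

Section TightGraphFunctionals.
Context {R : realType} {m : nat -> nat} {d : nat -> measure_display}.
Context {T : forall n, measurableType (d n)} {P : forall n, probability (T n) R}.
Variables (y : forall n, 'I_n -> R) (x : forall n, 'I_(m n) -> R) (mu : nat -> R).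
Variable H : forall n, T n -> {set 'I_n * 'I_(m n)}.
Hypothesis rbg : forall n, random_bipartite_graph (P n) (@y n) (@x n) (mu n) (@H n).

Lemma bigO_prob_graph (z : forall n, {set 'I_n * 'I_(m n)} -> R) (a : nat -> R)
    (C : R) (N : nat) :
  (forall n, (N <= n)%N -> 0 < a n /\
     Ex (graph_law (P n) (@H n)) (fun S => `|z n S|) <= C * a n) ->
  bigO_prob P (fun n w => z n (H w)) a.
Proof.
move=> zC eps eps0.
(* Tightness is required for all [n], but the mean bound holds only from [N] on. Below [N] there are
   finitely many graphs in all, so [K0] bounds the ratio surely; above [N], Markov's inequality
   needs [K >= C / eps]. The final [+ 1] keeps [K] positive. *)
pose K0 : R := \sum_(n < N) \sum_S `|z n S / a n|.
have K00 : 0 <= K0 by apply: sumr_ge0 => i _; apply: sumr_ge0.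
exists (K0 + `|C| / eps + 1) => n; set K := K0 + _ + _.
have Ceps0 : 0 <= `|C| / eps by rewrite divr_ge0 // ltW.
have K1 : 0 < K by rewrite ltr_wpDl // addr_ge0.
have [nN|Nn] := ltnP n N.
  rewrite (_ : [set w | _] = classical_sets.set0) ?measure0 ?lee_fin ?ltW //.
  apply/seteqP; split=> w //=; apply/negP; rewrite -leNgt.
  apply: (@le_trans _ _ K0); last by rewrite /K -addrA lerDl addr_ge0.
  rewrite /K0 (bigD1 (Ordinal nN)) //= (bigD1 (H w)) //= -addrA lerDl.
  by rewrite addr_ge0 ?sumr_ge0 // => i _; apply: sumr_ge0.
have [an0 Cn] := zC n Nn.
rewrite (_ : [set w | _] = [set w | K * a n < `|z n (H w)|]); last first.
  by apply/seteqP; split=> w /=; rewrite normrM normfV (gtr0_norm an0) ltr_pdivlMr.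
apply: le_trans (markov_graph (rbg n) _ _) _; first by rewrite mulr_gt0.
rewrite lee_fin ler_pdivrMr ?mulr_gt0 //; apply: le_trans Cn _.
rewrite mulrA ler_wpM2r ?(ltW an0) //; apply: le_trans (ler_norm C) _.
rewrite mulrC -ler_pdivrMr // /K.
by rewrite -addrA addrCA lerDl addr_ge0.
Qed.

End TightGraphFunctionals.

(** Termwise [1 + w] is at most twice the larger of 1 and [w], which gives the factor [2 ^+ s]. *)
Lemma sum_expr1D_le (R : realType) k s (w : 'I_k -> R) (c : R) :
  (0 < k)%N -> (forall i, 0 < w i) -> avg_pow w s < c ->
  \sum_i (1 + w i) ^+ s <= 2 ^+ s * (1 + c) * k%:R.
Proof.
move=> k0 w0; have k0R : 0 < k%:R :> R by rewrite ltr0n.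
rewrite /avg_pow ltr_pdivrMr // => /ltW wc.
apply: (@le_trans _ _ (\sum_i 2 ^+ s * (1 + w i ^+ s))).
  apply: ler_sum => i _; have wi0 := ltW (w0 i).
  have [w1|w1] := leP (w i) 1.
    apply: (@le_trans _ _ (2 ^+ s)); first by rewrite lerXn2r ?nnegrE //; lra.
    by rewrite ler_peMr ?exprn_ge0 // lerDl exprn_ge0.
  apply: (@le_trans _ _ ((2 * w i) ^+ s)); first by rewrite lerXn2r ?nnegrE //; lra.
  by rewrite exprMn ler_wpM2l ?exprn_ge0 // lerDr.
rewrite -big_distrr big_split /= sumr_const card_ord -mulrA ler_wpM2l ?exprn_ge0 //.
by rewrite mulrDl mul1r lerD2l.
Qed.

(** * The model at one fixed [n], with [k] in the role of [gamma_o] *)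

Section FixedSize.
Context {R : realType} {d : measure_display} {T : measurableType d}.
Context {P : probability T R} {n m : nat}.
Variables (y : 'I_n -> R) (x : 'I_m -> R) (H : T -> {set 'I_n * 'I_m}) (c k : R).
Let gam : R := Num.sqrt (m%:R / n%:R).
Let A : R := avg_pow x 3 * avg_pow y 1 ^+ 3.
Let B : R := avg_pow x 2 ^+ 2 * avg_pow y 2 * avg_pow y 1 ^+ 2.
Hypothesis n0 : (0 < n)%N.
Hypothesis m0 : (0 < m)%N.
Hypothesis y0 : forall i, 0 < y i.
Hypothesis x0 : forall u, 0 < x u.
Hypothesis c0 : 0 < c.
Hypothesis k0 : 0 < k.
Hypothesis xc : avg_pow x 5 < c.
Hypothesis yc : avg_pow y 4 < c.
Hypothesis gamk : k / 2 <= gam <= 2 * k.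
Hypothesis gamn : 1 <= gam * n%:R.
Hypothesis rbg : random_bipartite_graph P y x (Num.sqrt (n%:R * m%:R)) H.

(** With [mu = s * t], the two moment sums are at most [32 * (1 + c) * (t / s) * mu] and
    [16 * (1 + c) * (s / t) * mu], where [t / s <= 2 * k] and [s / t <= 2 / k]. The leading 1
    ensures [1 <= L]. *)
Let L : R := 1 + 64 * (1 + c) * (k + k^-1).
Let s : R := Num.sqrt n%:R.
Let t : R := Num.sqrt m%:R.
Let s0 : 0 < s. Proof. by rewrite sqrtr_gt0 ltr0n. Qed.
Let t0 : 0 < t. Proof. by rewrite sqrtr_gt0 ltr0n. Qed.
Let ns : n%:R = s ^+ 2 :> R. Proof. by rewrite sqr_sqrtr. Qed.
Let mt : m%:R = t ^+ 2 :> R. Proof. by rewrite sqr_sqrtr. Qed.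
Let gamE : gam = t / s.
Proof. by rewrite /gam sqrtrM ?ler0n // sqrtrV ?ler0n. Qed.
Let muE : Num.sqrt (n%:R * m%:R) = s * t.
Proof. by rewrite sqrtrM ?ler0n. Qed.

(** Converts errors of order [sqrt mu] into order [sqrt n]. Bounding [2 * k] by [(1 + 2 * k) ^+ 2]
    avoids a root of [k]. *)
Lemma sqrt_scale_le : Num.sqrt (s * t) <= (1 + 2 * k) * s.
Proof.
have /andP [_ g2] := gamk; rewrite -[leRHS]ger0_norm; last first.
  by rewrite mulr_ge0 ?(ltW s0) //; have := k0; lra.
rewrite -sqrtr_sqr ler_wsqrtr //.
move: g2; rewrite gamE ler_pdivrMr // => ts.
apply: (@le_trans _ _ (2 * k * s ^+ 2)).
  by rewrite expr2 mulrA [leRHS]mulrC ler_wpM2l // ltW.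
rewrite exprMn ler_wpM2r ?sqr_ge0 // -subr_ge0.
rewrite (_ : _ - _ = 1 + 2 * k + (2 * k) ^+ 2); last by ring.
by rewrite !addr_ge0 ?sqr_ge0 // mulr_ge0 // ltW.
Qed.

Let wts : sparse_weights y x (s * t) L.
Proof.
have /andP [g1 g2] := gamk; move: g1 g2; rewrite gamE => g1 g2.
have kv0 : 0 < k^-1 by rewrite invr_gt0.
have st0 : 0 < s * t by rewrite mulr_gt0.
have c1 : 0 < 1 + c by rewrite addr_gt0.
split=> [||i|u|].
- by move: gamn; rewrite gamE ns (_ : t / s * s ^+ 2 = s * t) //; field; rewrite gt_eqF.
- by rewrite lerDl !mulr_ge0 // ?ltW // addr_gt0.
- exact: ltW.
- exact: ltW.
split.
  apply: le_trans (sum_expr1D_le n0 y0 yc) _.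
  have -> : 2 ^+ 4 * (1 + c) * n%:R = 16 * (1 + c) * (s / t) * (s * t) :> R.
    by rewrite ns; field; rewrite gt_eqF.
  rewrite ler_wpM2r ?(ltW st0) //.
  have st : s / t <= 2 * k^-1.
    rewrite -[s / t]invf_div -[2 * k^-1]invf_div lef_pV2 ?posrE ?divr_gt0 //.
  have : 16 * (1 + c) * (s / t) <= 16 * (1 + c) * (2 * k^-1).
    by rewrite ler_wpM2l // mulr_ge0 // ltW.
  have : 0 <= (1 + c) * k by rewrite mulr_ge0 // ltW.
  have : 0 <= (1 + c) * k^-1 by rewrite mulr_ge0 // ltW.
  rewrite /L; set z1 := (1 + c) * k^-1; set z2 := (1 + c) * k => ? ? h.
  apply: le_trans h _; rewrite (_ : 16 * _ * _ = 32 * z1); last by rewrite /z1; ring.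
  rewrite (_ : 64 * _ * _ = 64 * z1 + 64 * z2); last by rewrite /z1 /z2; ring.
  lra.
apply: le_trans (sum_expr1D_le m0 x0 xc) _.
have -> : 2 ^+ 5 * (1 + c) * m%:R = 32 * (1 + c) * (t / s) * (s * t) :> R.
  by rewrite mt; field; rewrite gt_eqF.
rewrite ler_wpM2r ?(ltW st0) //.
have : 32 * (1 + c) * (t / s) <= 32 * (1 + c) * (2 * k).
  by rewrite ler_wpM2l // mulr_ge0 // ltW.
have : 0 <= (1 + c) * k by rewrite mulr_ge0 // ltW.
have : 0 <= (1 + c) * k^-1 by rewrite mulr_ge0 // ltW.
rewrite /L; set z1 := (1 + c) * k^-1; set z2 := (1 + c) * k => ? ? h.
apply: le_trans h _; rewrite (_ : 32 * _ * _ = 64 * z2); last by rewrite /z2; ring.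
rewrite (_ : 64 * _ * _ = 64 * z1 + 64 * z2); last by rewrite /z1 /z2; ring.
lra.
Qed.

Let law : inclusion_law (graph_law P H) (edge_prob y x (s * t)).
Proof. by rewrite -muE; exact: graph_law_inclusion. Qed.

Let prb : sparse_probs (edge_prob y x (s * t)) y x (s * t).
Proof.
by apply: edge_prob_sparse => [|i|u]; rewrite ?mulr_gt0 ?ltW.
Qed.

Let st2 : Num.sqrt (s * t) ^+ 2 = s * t.
Proof. by rewrite sqr_sqrtr // mulr_ge0 // ltW. Qed.

Let st0 : 0 < Num.sqrt (s * t).
Proof. by rewrite sqrtr_gt0 mulr_gt0. Qed.

Let st_neq0 : s * t != 0.
Proof. by rewrite gt_eqF ?mulr_gt0. Qed.

Let L0 : 0 <= L.
Proof. by case: wts => _ L1 _ _ _; apply: le_trans L1. Qed.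

Let claw_avg : claw_mean y x (s * t) = n%:R / gam * A.
Proof.
rewrite claw_meanE // /A /avg_pow gamE ns mt.
under [X in _ = _ * (_ * (X / _) ^+ 3)]eq_bigr do rewrite expr1.
by field; rewrite !gt_eqF.
Qed.

Let wpath_avg : wpath_mean y x (s * t) = n%:R * B.
Proof.
rewrite wpath_meanE // /B /avg_pow ns mt.
under [X in _ = _ * (_ * (X / _) ^+ 2)]eq_bigr do rewrite expr1.
by field; rewrite !gt_eqF.
Qed.

Lemma num_triangles_L1 :
  Ex (graph_law P H) (fun S => `|6 * (num_triangles (affiliation_graph S))%:R -
    n%:R / gam * A|) <= 225 * L ^+ 6 * (1 + 2 * k) * s.
Proof.
rewrite -claw_avg; apply: le_trans (triangles_deviation law wts prb st0 st2) _.
rewrite -[leRHS]mulrA; apply: ler_wpM2l; last exact: sqrt_scale_le.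
exact: (mulr_ge0 (ler0n _ _) (exprn_ge0 _ L0)).
Qed.

Lemma num_2paths_L1 :
  Ex (graph_law P H) (fun S => `|2 * (num_2paths (affiliation_graph S))%:R -
    (n%:R / gam * A + n%:R * B)|) <= 500 * L ^+ 8 * (1 + 2 * k) * s.
Proof.
rewrite -claw_avg -wpath_avg; apply: le_trans (paths_deviation law wts prb st0 st2) _.
rewrite -[leRHS]mulrA; apply: ler_wpM2l; last exact: sqrt_scale_le.
exact: (mulr_ge0 (ler0n _ _) (exprn_ge0 _ L0)).
Qed.

End FixedSize.

(** * Ratio estimates and the final limit *)

Lemma avg_pow_ge0 (R : realType) k (w : 'I_k -> R) s :
  (forall i, 0 < w i) -> 0 <= avg_pow w s.
Proof.
by move=> w0; rewrite divr_ge0 // sumr_ge0 // => i _; rewrite exprn_ge0 // ltW.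
Qed.

(** The convention for triangle-free graphs agrees with the quotient because the numerator vanishes.
    The factors 6 and 2 match the ordered counts. *)
Lemma global_clusteringE (R : realType) (V : finType) (G : rel V) :
  global_clustering R G = 6 * (num_triangles G)%:R / (2 * (num_2paths G)%:R).
Proof.
rewrite /global_clustering; case: eqP => [->|_]; first by rewrite mulr0 mul0r.
by rewrite -mulf_div (_ : 6 / 2 = 3) ?mulrA // ; field.
Qed.

(** The difference is [((N - a) - a / b * (M - b)) / M], where [a / b <= 1], and [e <= 2^-1] keeps
    [M] above [b / 2]. *)
Lemma ratio_perturb (R : realType) (N M a b e : R) :
  0 <= a <= b -> 0 < b -> e <= 2^-1 -> `|N - a| + `|M - b| <= b * e ->
  `|N / M - a / b| <= 2 * e.
Proof.
move=> /andP [a0 ab] b0 e2 h.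
have be : b * e <= b / 2 by rewrite ler_wpM2l // ltW.
have Mb : b / 2 <= M.
  have := normr_ge0 (N - a); have := ler_norm (b - M); rewrite distrC; lra.
have M0 : 0 < M by lra.
rewrite (_ : N / M - a / b = ((N - a) - a / b * (M - b)) / M); last first.
  by field; rewrite !gt_eqF.
rewrite normrM normfV (gtr0_norm M0) ler_pdivrMr //.
apply: le_trans (ler_normB _ _) _; rewrite normrM ger0_norm; last first.
  by rewrite divr_ge0 // ltW.
have : a / b * `|M - b| <= `|M - b| by rewrite ler_piMl // ler_pdivrMr // mul1r.
have : b * e <= 2 * e * M.
  have e0 : 0 <= e by rewrite -(pmulr_rge0 _ b0); apply: le_trans h; rewrite addr_ge0.
  rewrite (_ : b * e = 2 * e * (b / 2)); last by field.
  by rewrite ler_wpM2l // mulr_ge0.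
lra.
Qed.

(** The difference factors as [(h - g) / h] times two fractions in the unit interval. The bound is
    uniform in [A] and [B], as required when these vary with [n] and may tend to 0. *)
Lemma clustering_limit_gap (R : realType) (A B g h : R) :
  0 <= A -> 0 <= B -> 0 < g -> 0 < h -> 0 < A + h * B ->
  `|A / (A + g * B) - A / (A + h * B)| <= `|g - h| / h.
Proof.
move=> A0 B0 g0 h0 hB.
have gB : 0 < A + g * B.
  have [A1|] := ltP 0 A; first by rewrite ltr_pwDl // mulr_ge0 // ltW.
  rewrite le_eqVlt ltNge A0 orbF => /eqP AE.
  move: hB; rewrite AE !add0r pmulr_rgt0 // => B1; exact: mulr_gt0.
rewrite (_ : _ - _ = (h - g) / h * (A / (A + g * B)) * (h * B / (A + h * B))); last first.
  by field; rewrite !gt_eqF.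
rewrite 2!normrM -mulrA [`|g - h|]distrC normrM normfV (gtr0_norm h0).
apply: ler_piMr; first by rewrite divr_ge0 // ltW.
have gB0 : 0 <= g * B by rewrite mulr_ge0 // ltW.
have hB0 : 0 <= h * B by rewrite mulr_ge0 // ltW.
rewrite !ger0_norm ?divr_ge0 ?(ltW hB) ?(ltW gB) //.
by rewrite mulr_ile1 ?divr_ge0 ?(ltW hB) ?(ltW gB) // ler_pdivrMr // mul1r ?lerDl ?lerDr.
Qed.

Theorem theorem3 (R : realType) (m : nat -> nat) (gamma_o : R)
    (hgamma_o : 0 < gamma_o)
    (hm : (m n)%:R / n%:R @[n --> \oo] --> gamma_o ^+ 2)
    (y : forall n : nat, 'I_n -> R) (x : forall n : nat, 'I_(m n) -> R)
    (hy : forall n i, 0 < y n i) (hx : forall n u, 0 < x n u)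
    (c : R) (hc : 0 < c)
    (hx5 : forall n, avg_pow (x n) 5 < c)
    (hy4 : forall n, avg_pow (y n) 4 < c)
    (d : nat -> measure_display) (T : forall n : nat, measurableType (d n))
    (P : forall n : nat, probability (T n) R)
    (H : forall n : nat, T n -> {set 'I_n * 'I_(m n)})
    (hH : forall n, random_bipartite_graph (P n) (y n) (x n)
                      (Num.sqrt (n%:R * (m n)%:R)) (H n)) :
  let gamma (n : nat) : R := Num.sqrt ((m n)%:R / n%:R) in
  let G (n : nat) (w : T n) := affiliation_graph (H n w) in
  let A (n : nat) : R := avg_pow (x n) 3 * avg_pow (y n) 1 ^+ 3 in
  let B (n : nat) : R :=
    avg_pow (x n) 2 ^+ 2 * avg_pow (y n) 2 * avg_pow (y n) 1 ^+ 2 in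
  [/\ bigO_prob P
        (fun n w => (num_triangles (G n w))%:R - n%:R / (6%:R * gamma n) * A n)
        (fun n => Num.sqrt n%:R),
      bigO_prob P
        (fun n w => (num_2paths (G n w))%:R
           - (n%:R / (2%:R * gamma n) * A n + n%:R / 2%:R * B n))
        (fun n => Num.sqrt n%:R)
    & (* the two error terms O_P(sqrt n) are negligible *)
      Num.sqrt n%:R * (A n + gamma_o * B n) @[n --> \oo] --> +oo ->
      littleo1_prob P
        (fun n w => global_clustering R (G n w)
                    - A n / (A n + gamma_o * B n))].
Proof.
move=> gamma G A B.
have gamma_cvg : gamma n @[n --> \oo] --> gamma_o.
  rewrite -[gamma_o]ger0_norm ?(ltW hgamma_o) // -sqrtr_sqr.
  exact: (continuous_cvg _ (@sqrt_continuous R _) hm).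
have gamma_dist e : 0 < e -> \forall n \near \oo, `|gamma_o - gamma n| < e.
  by move: gamma_cvg => /cvgrPdist_lt; exact.
have A0 n : 0 <= A n by rewrite mulr_ge0 ?exprn_ge0 ?avg_pow_ge0.
have B0 n : 0 <= B n.
  by apply: mulr_ge0; [apply: mulr_ge0|]; rewrite ?exprn_ge0 ?avg_pow_ge0.
(* From [N] on, the fixed-size estimates apply with [k = gamma_o]. Positivity of [m n] is read off
   from [gamma n], which would be 0 otherwise. *)
have [N _ HN] : \forall n \near \oo, [/\ (0 < n)%N, (0 < m n)%N,
    gamma_o / 2 <= gamma n <= 2 * gamma_o & 1 <= gamma n * n%:R].
  have go2 : 0 < gamma_o / 2 by rewrite divr_gt0.
  near=> n.
  have gd : `|gamma_o - gamma n| < gamma_o / 2.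
    by near: n; exact: gamma_dist.
  have nl : (gamma_o / 2)^-1 <= n%:R by near: n; exact: nbhs_infty_ger.
  have g1 : gamma_o / 2 <= gamma n.
    by have := ler_norm (gamma_o - gamma n); lra.
  have g2 : gamma n <= 2 * gamma_o.
    by have := ler_norm (gamma n - gamma_o); rewrite distrC; lra.
  have n0 : (0 < n)%N by rewrite -(ltr0n R) (lt_le_trans _ nl) // invr_gt0.
  split=> //; last 2 first.
  - by rewrite g1 g2.
  - rewrite -[leLHS](mulfV (lt0r_neq0 go2)).
    by apply: ler_pM; rewrite ?invr_ge0 ?(ltW go2).
  rewrite lt0n; apply/eqP => mn0; move: g1; rewrite /gamma mn0 mul0r sqrtr0.
  by rewrite leNgt go2.
pose L : R := 1 + 64 * (1 + c) * (gamma_o + gamma_o^-1).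
pose C1 : R := 225 * L ^+ 6 * (1 + 2 * gamma_o).
pose C2 : R := 500 * L ^+ 8 * (1 + 2 * gamma_o).
have L0 : 0 <= L.
  have [c0 g0] : 0 <= c /\ 0 <= gamma_o by rewrite !ltW.
  by rewrite addr_ge0 // mulr_ge0 ?addr_ge0 ?invr_ge0 // mulr_ge0 // addr_ge0.
have C120 : 0 <= C1 + C2.
  have k0 : 0 <= 1 + 2 * gamma_o by rewrite addr_ge0 // mulr_ge0 // ltW.
  have L0' j := exprn_ge0 j L0.
  exact: (addr_ge0 (mulr_ge0 (mulr_ge0 (ler0n _ _) (L0' _)) k0)
    (mulr_ge0 (mulr_ge0 (ler0n _ _) (L0' _)) k0)).
pose s n : R := Num.sqrt n%:R.
pose z1 n (S : {set 'I_n * 'I_(m n)}) : R :=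
  6 * (num_triangles (affiliation_graph S))%:R - n%:R / gamma n * A n.
pose z2 n (S : {set 'I_n * 'I_(m n)}) : R :=
  2 * (num_2paths (affiliation_graph S))%:R - (n%:R / gamma n * A n + n%:R * B n).
pose E n := Ex (graph_law (P n) (H n)).
have s0 n : (N <= n)%N -> 0 < s n.
  by move=> /HN [n0 _ _ _]; rewrite sqrtr_gt0 ltr0n.
have E1 n : (N <= n)%N -> E n (fun S => `|z1 n S|) <= C1 * s n.
  by move=> /HN [n0 m0 gk gn]; exact: (num_triangles_L1 n0 m0 (hy n) (hx n) hc hgamma_o).
have E2 n : (N <= n)%N -> E n (fun S => `|z2 n S|) <= C2 * s n.
  by move=> /HN [n0 m0 gk gn]; exact: (num_2paths_L1 n0 m0 (hy n) (hx n) hc hgamma_o).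
have gamma0 n : (N <= n)%N -> 0 < gamma n.
  by move=> /HN [_ _ /andP [g _] _]; apply: lt_le_trans g; rewrite divr_gt0.
have EZ n a f : Ex (graph_law (P n) (H n)) (fun S => `|a * f S|) =
    `|a| * Ex (graph_law (P n) (H n)) (fun S => `|f S|).
  by rewrite -ExZ; apply: eq_Ex => S; rewrite normrM.
split.
- apply: (bigO_prob_graph hH (z := fun n S => (num_triangles (affiliation_graph S))%:R -
      n%:R / (6%:R * gamma n) * A n) (C := C1) (N := N)) => n nN.
  split; first exact: s0.
  rewrite (eq_Ex (g := fun S => `|6^-1 * z1 n S|)); last first.
    by move=> S; congr `|_|; rewrite /z1; field; rewrite gt_eqF // gamma0.
  rewrite EZ; apply: le_trans (E1 n nN); rewrite ger0_norm // ler_piMl ?invf_le1 ?ler1n //.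
  by apply: Ex_ge0 => //; exact: graph_law_inclusion.
- apply: (bigO_prob_graph hH (z := fun n S => (num_2paths (affiliation_graph S))%:R -
      (n%:R / (2%:R * gamma n) * A n + n%:R / 2%:R * B n)) (C := C2) (N := N)) => n nN.
  split; first exact: s0.
  rewrite (eq_Ex (g := fun S => `|2^-1 * z2 n S|)); last first.
    by move=> S; congr `|_|; rewrite /z2; field; rewrite gt_eqF // gamma0.
  rewrite EZ; apply: le_trans (E2 n nN); rewrite ger0_norm // ler_piMl ?invf_le1 ?ler1n //.
  by apply: Ex_ge0 => //; exact: graph_law_inclusion.
move=> big eps eps0.
(* The perturbation of the ratio costs [2 * del <= eps / 2], and the other half of [eps] pays for
   replacing [gamma n] by [gamma_o]. The cap [2^-1] is the one that [ratio_perturb] asks for. *)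
pose del := Num.min 2^-1 (eps / 4) : R.
have del0 : 0 < del by rewrite lt_min invr_gt0 ltr0n divr_gt0.
have del2 : del <= 2^-1 by rewrite ge_min lexx.
have del4 : del <= eps / 4 by rewrite ge_min lexx orbT.
pose D n := A n + gamma_o * B n.
have big0 : \forall n \near \oo, 0 < s n * D n by move: big => /cvgryPgt; exact.
(* Markov's inequality at level [b * del] gives [(C1 + C2) * s n / (b * del)], and the main term
   satisfies [b >= s n * (s n * D n) / (4 * gamma_o)]. *)
pose C3 := (C1 + C2) * (4 * gamma_o) / del.
apply: (@squeeze_cvge _ _ _ _ (fun=> 0%E) _ (fun n => (C3 * (s n * D n)^-1)%:E)).
- near=> n; rewrite measure_ge0 /=.
  have nN : (N <= n)%N by near: n; exact: nbhs_infty_ge.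
  have sD0 : 0 < s n * D n by near: n; exact: big0.
  have gd : `|gamma_o - gamma n| < gamma_o * (eps / 2).
    near: n; apply: gamma_dist.
    by rewrite mulr_gt0 // divr_gt0.
  have sn0 := s0 _ nN; have gn0 := gamma0 _ nN; have [n0 _ /andP [g1 g2] _] := HN _ nN.
  have D0 : 0 < D n by rewrite -(pmulr_rgt0 _ sn0).
  have ns : n%:R = s n ^+ 2 by rewrite sqr_sqrtr.
  pose a := n%:R / gamma n * A n; pose b := a + n%:R * B n.
  have a0 : 0 <= a by rewrite mulr_ge0 // divr_ge0 // ltW.
  have ab : a <= b by rewrite lerDl mulr_ge0.
  have bD : s n * (s n * D n) <= b * (4 * gamma_o).
    rewrite /b /a ns /D.
    rewrite (_ : _ * (4 * gamma_o) = s n ^+ 2 * (4 * gamma_o / gamma n * A n + 4 * gamma_o * B n));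
      last by ring.
    rewrite mulrA -expr2 ler_wpM2l ?sqr_ge0 //; apply: lerD.
      by apply: ler_peMl => //; rewrite ler_pdivlMr //; lra.
    have gB : 0 <= gamma_o * B n := mulr_ge0 (ltW hgamma_o) (B0 n).
    by rewrite -[4 * _ * _]mulrA ler_peMl // ler1n.
  have b0 : 0 < b.
    have g4 : 0 < 4 * gamma_o by rewrite mulr_gt0.
    rewrite -(pmulr_lgt0 b g4).
    by apply: lt_le_trans bD; rewrite mulr_gt0.
  (* Off this event the clustering coefficient is deterministically within [eps] of its limit
     expression. The outer absolute value only gives the event the shape that [markov_graph]
     expects. *)
  apply: (@le_trans _ _ (P n [set w | b * del < `| `|z1 n (H n w)| + `|z2 n (H n w)| |])).
    apply: le_measure.
    + apply: mem_set; exact: (measurable_graph_pred (hH n) (fun S => eps <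
        `|global_clustering R (affiliation_graph S) - A n / (A n + gamma_o * B n)|)).
    + apply: mem_set; exact: (measurable_graph_pred (hH n) (fun S => b * del <
        `| `|z1 n S| + `|z2 n S| |)).
    move=> w /= h; rewrite ltNge; apply/negP; rewrite ger0_norm ?addr_ge0 // => hz.
    move: h; rewrite ltNge => /negP; apply; rewrite global_clusteringE.
    have := ratio_perturb (introT andP (conj a0 ab)) b0 del2 hz.
    have -> : a / b = A n / (A n + gamma n * B n).
      have bE : b = n%:R / gamma n * (A n + gamma n * B n).
        by rewrite /b /a; field; rewrite gt_eqF.
      by rewrite bE -mulf_div divff ?mul1r // mulf_neq0 ?invr_neq0 ?pnatr_eq0 -?lt0n ?gt_eqF.
    have := clustering_limit_gap (A0 n) (B0 n) gn0 hgamma_o D0.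
    set r := A n / _; set l := A n / _; set f := _ / _ => h1 h2.
    rewrite (_ : f - l = (f - r) + (r - l)); last by ring.
    apply: le_trans (ler_normD _ _) _.
    have : `|gamma n - gamma_o| / gamma_o <= eps / 2.
      by rewrite ler_pdivrMr // distrC mulrC ltW.
    lra.
  have bd0 : 0 < b * del by rewrite mulr_gt0.
  apply: le_trans (markov_graph (hH n) (fun S => `|z1 n S| + `|z2 n S|) bd0) _.
  rewrite lee_fin ler_pdivrMr ?mulr_gt0 //.
  rewrite (eq_Ex (g := fun S => `|z1 n S| + `|z2 n S|)); last first.
    by move=> S; rewrite ger0_norm ?addr_ge0.
  rewrite ExD; apply: le_trans (lerD (E1 _ nN) (E2 _ nN)) _.
  rewrite /C3 [leRHS](_ : _ = (C1 + C2) * (b * (4 * gamma_o) / (s n * D n))); last first.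
    by field; rewrite !gt_eqF.
  by rewrite -mulrDl ler_wpM2l // ler_pdivlMr.
- exact: cvg_cst.
have lim0 : (s n * D n)^-1 @[n --> \oo] --> (0 : R).
  by apply/gtr0_cvgV0.
rewrite -[0%E]/((0 : R)%:E) -(mulr0 C3).
apply: cvg_EFin; first exact: nearW.
exact: (cvgM (cvg_cst C3) lim0).
Unshelve. all: by end_near.
Qed.
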